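(* Let $d\ge2$, let $K$ be a $d$-dimensional convex body and let $0<\lambda<1$ be a real number. Then $$\mathrm{coin}_w(K)\le\frac{N_\lambda(K)}{1-\lambda}\le\begin{cases}\dfrac{(1+\lambda)^d}{\lambda^d(1-\lambda)}\,d(\ln d+\ln\ln d+5), & \text{if }K\text{ is }o\text{-symmetric},\\[3mm] \dfrac{1}{\lambda^d(1-\lambda)}\left(\binom{2d}{d}^{1/d}-1+\lambda\right)^d d(\ln d+\ln\ln d+5), & \text{otherwise}.\end{cases}$$
   Context: A $d$-dimensional convex body is a compact convex subset of Euclidean space $\mathbb{E}^d$ with nonempty interior; it is $o$-symmetric if $K=-K$. For $m\in\mathbb{N}=\{1,2,\dots\}$, $\gamma_m(K)=\inf\{\lambda>0:K\subseteq\bigcup_{i=1}^m(\lambda K+t_i),\ t_i\in\mathbb{E}^d\}$. The weak covering index is $$\mathrm{coin}_w(K)=\inf\left\{\frac{m}{1-\gamma_m(K)}:\gamma_m(K)<1,\ m\in\mathbb{N}\right\}.$$ For $0<\lambda\le1$, $N_\lambda(K)$ is the minimum number of translates of $\lambda K$ needed to cover $K$. *)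

(* Defs.v *)
(* E^d is the space 'rV[R]_d of real row vectors, R : realType. *)
From HB Require Import structures.
From mathcomp Require Import all_boot all_order all_algebra.
From mathcomp Require Import finmap.
From mathcomp Require Import all_classical all_reals all_analysis.

Set Implicit Arguments.
Unset Strict Implicit.
Unset Printing Implicit Defensive.

Import Order.TTheory GRing.Theory Num.Theory.
Import numFieldNormedType.Exports.

Local Open Scope classical_set_scope.
Local Open Scope ring_scope.

(* The sup norm that the library puts on 'rV[R]_d has the Euclidean topology,
   so [compact] and [interior] have their usual meaning. *)
Definition convex_body (R : realType) (d : nat) (K : set 'rV[R]_d) : Prop :=
  [/\ compact K, convex_set K & K° !=set0].

Definition o_symmetric (R : realType) (d : nat) (K : set 'rV[R]_d) : Prop :=
  K = -%R @` K.

Definition homothet (R : realType) (d : nat) (l : R) (t : 'rV[R]_d)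
    (K : set 'rV[R]_d) : set 'rV[R]_d :=
  [set l *: x + t | x in K].

Definition covered (R : realType) (d : nat) (K : set 'rV[R]_d)
    (l : R) (m : nat) : Prop :=
  exists t : 'I_m -> 'rV[R]_d, K `<=` \bigcup_i homothet l (t i) K.

Definition covering_functional (R : realType) (d : nat) (m : nat)
    (K : set 'rV[R]_d) : R :=
  inf [set l : R | 0 < l /\ covered K l m].

Definition coin_w (R : realType) (d : nat) (K : set 'rV[R]_d) : R :=
  inf [set m%:R / (1 - covering_functional m K)
      | m in [set m : nat | (0 < m)%N /\ covering_functional m K < 1]].

(* [xget] is a total choice; [covering_numberP] shows that the default value 0
   is never taken for a convex body and l > 0. *)
Definition covering_number (R : realType) (d : nat) (l : R)
    (K : set 'rV[R]_d) : nat :=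
  xget 0%N [set m | covered K l m /\ forall n, covered K l n -> (m <= n)%N].

Lemma covered_exists (R : realType) (d : nat) (K : set 'rV[R]_d) (l : R) :
  convex_body K -> 0 < l -> exists m, covered K l m.
Proof.
move=> [cK _ [p /nbhs_ballP[r /= r0 prK]]] l0.
move: cK; rewrite compact_cover.
move=> /(_ 'rV[R]_d K (fun c => ball c (l * r))) [].
- by move=> c _; apply: ball_open.
- by move=> x Kx; exists x => //; apply: ballxx; exact: mulr_gt0.
move=> D _ DK; exists (size (enum_fset D)).
exists (fun i => nth 0 (enum_fset D) i - l *: p) => y /DK[c /= cD cy].
have iD : (index c (enum_fset D) < size (enum_fset D))%N by rewrite index_mem.
exists (Ordinal iD) => //=; exists (p + l^-1 *: (y - c)).
  apply: prK; move: cy.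
  rewrite -!ball_normE /= opprD addrA subrr add0r normrN normrZ.
  by rewrite gtr0_norm ?invr_gt0// ltr_pdivrMl// distrC.
rewrite nth_index// scalerDr scalerA divff ?gt_eqF// scale1r.
by rewrite addrC addrA addrNK addrC addrNK.
Qed.

Lemma covering_numberP (R : realType) (d : nat) (K : set 'rV[R]_d) (l : R) :
  convex_body K -> 0 < l ->
  covered K l (covering_number l K) /\
  forall n, covered K l n -> (covering_number l K <= n)%N.
Proof.
move=> Kb l0; have [m0 m0P] := covered_exists Kb l0.
have ex : exists m, `[< covered K l m >] by exists m0; exact/asboolP.
apply: (xgetPex 0%N (P := [set m | covered K l m /\
  forall n, covered K l n -> (m <= n)%N])).
case: (ex_minnP ex) => m /asboolP Km mmin; exists m; split=> // n /asboolP.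
exact: mmin.
Qed.

Lemma covered1 (R : realType) (d : nat) (K : set 'rV[R]_d) (m : nat) :
  (0 < m)%N -> covered K 1 m.
Proof.
case: m => // m _; exists (fun=> 0) => x Kx; exists ord0 => //.
by exists x => //; rewrite scale1r addr0.
Qed.

(* The real-valued [inf]s above are over nonempty sets: [covered1] for
   [covering_functional], and the next lemma for [coin_w]. *)
Lemma covering_functional_lt1 (R : realType) (d : nat) (K : set 'rV[R]_d) :
  convex_body K -> exists2 m, (0 < m)%N & covering_functional m K < 1.
Proof.
move=> Kb; have h0 : (0 : R) < 2^-1 by rewrite invr_gt0.
have [m Km] := covered_exists Kb h0.
have m0 : (0 < m)%N.
  case: m Km => // -[t Kt]; case: Kb => _ _ [p /interior_subset/Kt].
  by case=> -[].
exists m => //; apply: (@le_lt_trans _ _ 2^-1); last by rewrite invf_lt1// ltr1n.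
by apply: ge_inf; [exists 0 => x [/ltW]|split].
Qed.

(* Main.v *)
Require Import Defs.
From HB Require Import structures.
From mathcomp Require Import all_boot all_order all_algebra.
From mathcomp Require Import finmap zify ring lra.
From mathcomp Require Import all_classical all_reals all_analysis.
Set Implicit Arguments.
Unset Strict Implicit.
Unset Printing Implicit Defensive.
Import Order.TTheory GRing.Theory Num.Theory.
Import numFieldNormedType.Exports.
Local Open Scope classical_set_scope.
Local Open Scope ring_scope.

(** The first inequality holds because m = N_lambda(K) translates of lambda K
cover K, so that gamma_m(K) <= lambda.

For the second one, let E = K - lambda K. The proof of C. A. Rogers' bound on
the density of coverings by translates, run on K itself instead of on a large
torus, gives

  N_lambda(K) <= vol(E) / (lambda^d vol(K)) * d (ln d + ln ln d + 5).

Write lambda K = (1 + eta) L. Averaging over the translates t + L with t in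
E finds one that covers at least a proportion vol(L)/vol(E) of any part of
K - eta L, so N greedy steps leave a part U of volume at most
vol(E) exp(- N vol(L)/vol(E)). Next take a maximal family of disjoint
translates of -Q inside U, where Q is a small set contained in eta L. If
x - Q meets a chosen t + L then x is in t + L + Q, contained in t + lambda K;
otherwise x - Q meets a member b - Q of the family, and x is in b + Q - Q. The
set Q is the intersection of eta L with one of its reflections x0 - eta L, so
that Q - Q = Q + Q - x0 lies in a translate of 2 eta L, and x0 is chosen by
averaging so that Q has volume at least (eta/2)^d vol(L). Balancing the two
families gives vol(E)/vol(L) * (d ln (2/eta) + 1) + 1 translates, and
[exists_good_eta] picks eta of order 1/(d ln d).

It remains to bound vol(E). For symmetric K, E = (1 + lambda) K. Otherwise
K - K contains E - (1 - lambda) K, so the Brunn-Minkowski inequality bounds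
vol(E)^(1/d) by vol(K - K)^(1/d) - (1 - lambda) vol(K)^(1/d), and the
Rogers-Shephard inequality vol(K - K) <= 'C(2d, d) vol(K) concludes.

The whole argument is carried out by counting integer points. The volume of K
is the limit of |s K meet Z^d| / s^d as s grows ([solid_volume]); the averaging
arguments become double counts of finite sets; Brunn-Minkowski is proved for
finite sets A, B of integer vectors, with A + B thickened by the cube {0, 1}^d
([brunn_minkowski_rV]); and Rogers-Shephard follows from counting pairs of
integer points of s K according to their difference. Replacing a real vector
by an integer one moves it by a vector of a fixed multiple of K, which changes
the scale s by a bounded amount and is invisible in the limit
([volume_affine]). *)

(** * Greedy covering and maximal packing in abelian groups *)

Lemma card_fsep (T : choiceType) (A : {fset T}) (P : pred T) :
  #|` [fset x in A | P x]%fset| = (\sum_(x <- A) P x)%N.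
Proof.
rewrite card_fset_sum1 -big_fset_condE/= big_mkcond/=.
by apply: eq_big_seq => x _; case: (P x).
Qed.

Lemma card_fset_le1 (T : choiceType) (A : {fset T}) :
  (forall x y, x \in A -> y \in A -> x = y) -> (#|` A| <= 1)%N.
Proof.
move=> A1; have [->|[x xA]] := fset_0Vmem A; first by rewrite cardfs0.
rewrite -(cardfs1 x); apply/fsubset_leq_card/fsubsetP => y yA.
by rewrite inE (A1 _ _ yA xA).
Qed.

Lemma double_count (T S : choiceType) (A : {fset T}) (B : {fset S})
    (r : T -> S -> bool) :
  (\sum_(x <- A) #|` [fset y in B | r x y]%fset| =
   \sum_(y <- B) #|` [fset x in A | r x y]%fset|)%N.
Proof.
under eq_bigr do rewrite card_fsep.
by rewrite exchange_big/=; under [RHS]eq_bigr do rewrite card_fsep.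
Qed.

Lemma exists_ge_average (T : choiceType) (A : {fset T}) (f : T -> nat) :
  A != fset0 ->
  exists2 x, x \in A & (\sum_(y <- A) f y <= #|` A| * f x)%N.
Proof.
move=> A0; apply: contrapT => H.
have {}H x : x \in A -> (#|` A| * f x < \sum_(y <- A) f y)%N.
  by move=> xA; rewrite ltnNge; apply/negP => xH; apply: H; exists x.
have [x0 x0A] := fset0Pn _ A0.
have : (\sum_(x <- A) (#|` A| * f x) < \sum_(x <- A) \sum_(y <- A) f y)%N.
  rewrite big_seq [ltnRHS]big_seq.
  rewrite (big_rem x0) //= [ltnRHS](big_rem x0)//= x0A.
  rewrite -addSn leq_add ?H//; apply: leq_sum => x xA.
  exact/ltnW/H.
by rewrite -big_distrr/= big_const_seq count_predT iter_addn_0 mulnC ltnn.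
Qed.

Section Sumsets.
Variable V : zmodType.
Implicit Types (A B C P Q U W : {fset V}).

Definition sumset A B : {fset V} := [fset (x + y)%R | x in A, y in B]%fset.

Lemma sumsetP A B z :
  reflect (exists2 x, x \in A & exists2 y, y \in B & z = x + y)
    (z \in sumset A B).
Proof.
apply: (iffP idP) => [/imfset2P[x /= xA [y /= yB ->]]|[x xA [y yB ->]]].
  by exists x => //; exists y.
by apply/imfset2P; exists x => //; exists y.
Qed.

Lemma mem_sumset A B x y : x \in A -> y \in B -> x + y \in sumset A B.
Proof. by move=> xA yB; apply/sumsetP; exists x => //; exists y. Qed.

Definition translate (t : V) A : {fset V} := [fset (t + x)%R | x in A]%fset.

Lemma mem_translate t A x : (x \in translate t A) = (x - t \in A).
Proof.
apply/imfsetP/idP => [[y /= yA ->]|xA]; first by rewrite addrC addKr.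
by exists (x - t) => //; rewrite addrC subrK.
Qed.

Lemma card_translate t A : #|` translate t A| = #|` A|.
Proof. by rewrite card_imfset//; exact: addrI. Qed.

Definition oppset A : {fset V} := [fset (- x)%R | x in A]%fset.

Lemma mem_oppset A x : (x \in oppset A) = (- x \in A).
Proof.
apply/imfsetP/idP => [[y /= yA ->]|xA]; first by rewrite opprK.
by exists (- x) => //; rewrite opprK.
Qed.

Lemma card_oppset A : #|` oppset A| = #|` A|.
Proof. by rewrite card_imfset//; exact: oppr_inj. Qed.

(** Each u in U lies in t + P for exactly |P| elements t of W, so on average over
W a translate t + P captures a proportion |P|/|W| of U. *)
Lemma greedy_step U P W :
  (forall u p, u \in U -> p \in P -> u - p \in W) -> W != fset0 ->
  exists t, (#|` U `\` translate t P|%fset * #|` W| <=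
             #|` U| * (#|` W| - #|` P|))%N.
Proof.
move=> UPW W0.
have [t tW tU] := @exists_ge_average V W
  (fun t => #|` [fset u in U | (u - t)%R \in P]%fset|) W0.
exists t; move: tU; rewrite (double_count W U (fun t u => u - t \in P)) => tU.
have {tU} : (#|` U| * #|` P| <= #|` W| * #|` [fset u in U | (u - t)%R \in P]%fset|)%N.
  apply: leq_trans tU; rewrite (card_fset_sum1 U) big_distrl/=.
  rewrite big_seq [leqRHS]big_seq; apply: leq_sum => u uU.
  rewrite mul1n -(card_oppset P) -(card_translate u).
  apply/fsubset_leq_card/fsubsetP => x; rewrite mem_translate mem_oppset opprB.
  by rewrite !inE/= => xP; rewrite xP andbT -(subKr u x) UPW.
have <- : (U `&` translate t P)%fset = [fset u in U | (u - t)%R \in P]%fset.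
  by apply/fsetP => u; rewrite !inE/= mem_translate.
have := cardfsID (translate t P) U; nia.
Qed.

Lemma greedy U P W (N : nat) :
  (forall u p, u \in U -> p \in P -> u - p \in W) -> W != fset0 ->
  exists T : seq V, size T = N /\
   (#|` [fset u in U | all (fun t => (u - t)%R \notin P) T]%fset| * #|` W| ^ N <=
             #|` U| * (#|` W| - #|` P|) ^ N)%N.
Proof.
move=> UPW W0; elim: N => [|N [T [TN IH]]].
  exists [::]; split=> //; rewrite !expn0 !muln1.
  by apply/fsubset_leq_card/fsubsetP => x; rewrite !inE => /andP[].
have [|t Ht] := @greedy_step [fset u in U | all (fun t => (u - t)%R \notin P) T]%fset
  P W _ W0.
  by move=> u p; rewrite !inE/= => /andP[uU _] pP; exact: UPW.
exists (t :: T); split=> /=; first by rewrite TN.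
rewrite !expnS; move: IH Ht.
have -> : [fset u in U | ((u - t)%R \notin P) && all (fun t => (u - t)%R \notin P) T]%fset
  = ([fset u in U | all (fun t => (u - t)%R \notin P) T] `\` translate t P)%fset.
  by apply/fsetP => u; rewrite !inE/= mem_translate andbCA.
set k := (_ - _)%N.
move=> IH Ht; rewrite [leqRHS]mulnCA [leqLHS]mulnA.
apply: (leq_trans (leq_mul Ht (leqnn _))).
by rewrite mulnAC [leqRHS]mulnC leq_mul2r IH orbT.
Qed.

(** The family is built by removing x - Q from U as long as some x - Q fits. If
x - Q was inside U at first, then some x - q has been removed together with a
set b - Q, and x - q = b - q'. *)
Lemma maximal_packing A Q U : Q != fset0 ->
  exists B : seq V, (size B * #|` Q| <= #|` U|)%N /\
    forall x, x \in A -> (forall q, q \in Q -> x - q \in U) ->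
      exists b q q', [/\ b \in B, q \in Q, q' \in Q & x = b + (q - q')].
Proof.
move=> Q0; have [n] := ubnP #|` U|; elim: n U => // n IH U Un.
have [[x [xA xQ]]|nx] := pselect (exists x, x \in A /\
    forall q, q \in Q -> x - q \in U); last first.
  by exists [::]; split=> // x xA xQ; exfalso; apply: nx; exists x.
pose X := translate x (oppset Q).
have XU : (X `<=` U)%fset.
  apply/fsubsetP => y; rewrite mem_translate mem_oppset opprB => /xQ.
  by rewrite subKr.
have cX : #|` X| = #|` Q| by rewrite card_translate card_oppset.
have UX : (#|` U `\` X|%fset + #|` Q| = #|` U|)%N.
  by rewrite cardfsDS// cX subnK// -cX fsubset_leq_card.
have Q1 : (0 < #|` Q|)%N by rewrite cardfs_gt0.
have [|B [BU HB]] := IH (U `\` X)%fset.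
  by rewrite -ltnS (leq_trans _ Un)// ltnS -UX -addn1 leq_add2l.
exists (x :: B); split=> [|y yA yQ].
  by rewrite /= mulSn -UX addnC leq_add2r.
have [yX|] := pselect (forall q, q \in Q -> y - q \in (U `\` X)%fset).
  have [b [q [q' [bB qQ q'Q ->]]]] := HB _ yA yX.
  by exists b, q, q'; split=> //; rewrite inE bB orbT.
move=> /existsNP[q /not_implyP[qQ]]; rewrite inE yQ// andbT => /negP/negPn.
rewrite mem_translate mem_oppset => q'Q.
exists x, q, (- (y - q - x)); split=> //; first by rewrite inE eqxx.
by rewrite opprK [q + _]addrC [_ - x + q]addrAC (subrK q) [x + _]addrC (subrK x).
Qed.

End Sumsets.

(** Q = H meet (x - H) is symmetric about x/2, so that Q - Q = Q + Q - x is inside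
a translate of H + H. The sum over x in H + H of the sizes of these sets is
|H|^2, hence one of them is as large as the average. This dispenses with a
point of reflection for which -H is contained in a multiple of H. *)
Lemma large_symmetric_subset (V : zmodType) (H : {fset V}) : H != fset0 ->
  exists x, exists Q : {fset V}, [/\ (Q `<=` H)%fset,
    forall q, q \in Q -> x - q \in H &
    (#|` H| ^ 2 <= #|` sumset H H| * #|` Q|)%N].
Proof.
move=> H0; have [h0 h0H] := fset0Pn _ H0.
have [|x xH xavg] := @exists_ge_average _ (sumset H H)
    (fun x => #|` [fset h in H | (x - h)%R \in H]%fset|).
  by apply/fset0Pn; exists (h0 + h0); rewrite mem_sumset.
exists x, [fset h in H | (x - h)%R \in H]%fset; split.
- by apply/fsubsetP => y; rewrite !inE => /andP[].
- by move=> q; rewrite !inE => /andP[].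
apply: leq_trans xavg.
rewrite (double_count (sumset H H) H (fun x h => (x - h)%R \in H)).
rewrite (card_fset_sum1 H) expnS expn1 -{1}(card_fset_sum1 H) big_distrr/=.
rewrite big_seq [leqRHS]big_seq; apply: leq_sum => h hH.
rewrite muln1 -(card_translate h H); apply/fsubset_leq_card/fsubsetP => y.
by rewrite mem_translate !inE/= => yH; rewrite yH andbT -(subrK h y) mem_sumset.
Qed.

(** T1 comes from N greedy steps applied to A - Q, and T2 is a maximal packing of
translates of -Q in what these steps leave uncovered: either a - Q meets some
t + P, or it meets some b - Q. *)
Lemma cover_by_greedy_and_packing (R : realType) (V : zmodType)
    (A P Q W : {fset V}) (N : nat) :
  A != fset0 -> P != fset0 -> Q != fset0 -> W != fset0 ->
  (forall a p q, a \in A -> p \in P -> q \in Q -> a - q - p \in W) ->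
  exists T1 T2 : seq V,
  [/\ size T1 = N,
      (size T2)%:R * #|` Q|%:R <=
        #|` W|%:R * expR (- (N%:R * (#|` P|%:R / #|` W|%:R))) :> R &
      forall a, a \in A ->
        (exists t p q, [/\ t \in T1, p \in P, q \in Q & a = t + (p + q)]) \/
        (exists b q q', [/\ b \in T2, q \in Q, q' \in Q & a = b + (q - q')])].
Proof.
move=> A0 P0 Q0 W0 APQW.
pose X := sumset A (oppset Q).
have XW u p : u \in X -> p \in P -> u - p \in W.
  move=> /sumsetP[a aA [q]]; rewrite mem_oppset => qQ ->{u} pP.
  by rewrite -[q]opprK APQW.
have [T1 [T1N T1U]] := greedy N XW W0.
set U := [fset _ in _ | _]%fset in T1U.
have [T2 [T2U HT2]] := maximal_packing A U Q0.
exists T1, T2; split => //; last first.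
  move=> a aA; have [aU|] := pselect (forall q, q \in Q -> a - q \in U).
    by right; exact: HT2.
  move=> /existsNP[q /not_implyP[qQ]] /negP.
  rewrite !inE/= mem_sumset ?mem_oppset ?opprK//= => /allPn[t tT /negPn tP].
  left; exists t, (a - q - t), q; split=> //.
  by rewrite [_ - t + q]addrAC (subrK q) [t + _]addrC (subrK t).
have [x0 x0P] := fset0Pn _ P0.
have W1 : (0 < #|` W|)%N by rewrite cardfs_gt0.
have cX : (#|` X| <= #|` W|)%N.
  rewrite -(card_translate (- x0) X); apply/fsubset_leq_card/fsubsetP => x.
  by rewrite mem_translate opprK => /XW /(_ x0P); rewrite addrK.
have PW : (#|` P| <= #|` W|)%N.
  have [u uX] : exists u, u \in X.
    have [a aA] := fset0Pn _ A0; have [q qQ] := fset0Pn _ Q0.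
    by exists (a - q); rewrite mem_sumset ?mem_oppset ?opprK.
  rewrite -(card_oppset P) -(card_translate u); apply/fsubset_leq_card/fsubsetP => x.
  rewrite mem_translate mem_oppset opprB => xP.
  by rewrite -(subKr u x) XW.
have W1' : 0 < (#|` W|%:R : R) by rewrite ltr0n.
apply: (@le_trans _ _ (#|` U|%:R)); first by rewrite -natrM ler_nat.
have ratio1 : #|` P|%:R / #|` W|%:R <= 1 :> R.
  by rewrite ler_pdivrMr// mul1r ler_nat.
apply: (@le_trans _ _ (#|` X|%:R * (1 - #|` P|%:R / #|` W|%:R) ^+ N)); last first.
  apply: ler_pM => //; rewrite ?ler_nat ?exprn_ge0 ?subr_ge0//.
  set x := _ / _ in ratio1 *.
  have -> : expR (- (N%:R * x)) = expR (- x) ^+ N.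
    by rewrite -expRM_natr mulNr [x * _]mulrC.
  rewrite lerXn2r ?nnegrE ?subr_ge0 ?expR_ge0//.
  exact: expR_ge1Dx.
rewrite -(ler_pM2r (exprn_gt0 N W1')) -mulrA -exprMn mulrBl mul1r.
by rewrite divfK ?gt_eqF// -natrB// -!natrX -!natrM ler_nat.
Qed.

(** * A Brunn-Minkowski inequality for finite sets of integer vectors *)

Section BrunnMinkowski.
Variable R : realType.

Lemma exists_root (n : nat) (y : R) : (0 < n)%N -> 0 <= y ->
  exists2 x, 0 <= x & x ^+ n = y.
Proof.
move=> n0 y0; exists (y `^ n%:R^-1); first exact: powR_ge0.
by rewrite -powR_mulrn ?powR_ge0// -powRrM mulVf ?powRr1// pnatr_eq0 -lt0n.
Qed.

Lemma power_tangent_le (n : nat) (x y : R) : 0 <= x -> 0 <= y ->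
  y ^+ n.+1 + n.+1%:R * y ^+ n * (x - y) <= x ^+ n.+1.
Proof.
move=> x0 y0; elim: n => [|n IH]; first by rewrite expr0 !expr1; lra.
rewrite [leRHS]exprS; apply: le_trans (ler_wpM2l x0 IH).
rewrite -subr_ge0; set e := (X in 0 <= X).
have -> : e = n.+1%:R * y ^+ n * (x - y) ^+ 2.
  by rewrite /e !exprS -!natr1; ring.
by rewrite mulr_ge0 ?sqr_ge0// mulr_ge0// exprn_ge0.
Qed.

(** Jensen's inequality for x^(n+1) with weights M and N, obtained by averaging the
tangent inequality at the weighted mean. *)
Lemma power_mean_le (n : nat) (M N p q : R) : 0 < M -> 0 < N -> 0 <= p -> 0 <= q ->
  (M * p + N * q) ^+ n.+1 <= (M + N) ^+ n * (M * p ^+ n.+1 + N * q ^+ n.+1).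
Proof.
move=> M0 N0 p0 q0; have MN : 0 < M + N by lra.
set m := (M * p + N * q) / (M + N).
have m0 : 0 <= m by rewrite divr_ge0 ?addr_ge0 ?mulr_ge0// ltW.
have E : M * p + N * q = (M + N) * m by rewrite [RHS]mulrC divfK// gt_eqF.
have Hp := power_tangent_le n p0 m0; have Hq := power_tangent_le n q0 m0.
have H := lerD (ler_wpM2l (ltW M0) Hp) (ler_wpM2l (ltW N0) Hq).
rewrite E exprMn exprSr -mulrA ler_wpM2l ?exprn_ge0 ?(ltW MN)//.
apply: le_trans H; rewrite le_eqVlt -subr_eq0.
set c := n.+1%:R * _; set X := m ^+ n.+1.
have -> : (M + N) * X - (M * (X + c * (p - m)) + N * (X + c * (q - m))) =
  c * ((M + N) * m - (M * p + N * q)) by ring.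
by rewrite E subrr mulr0 eqxx.
Qed.

Lemma count_thresholds_le (k : nat) (y : R) : 0 <= y ->
  (\sum_(j < k) (j.+1%:R <= y)%R)%N%:R <= y.
Proof.
move=> y0; elim: k => [|k IH]; first by rewrite big_ord0.
rewrite big_ord_recr/=; have [ky|] := boolP (k.+1%:R <= y); last by rewrite addn0.
apply: le_trans ky; rewrite ler_nat addn1 ltnS.
by rewrite -[leqRHS]card_ord -sum1_card; apply: leq_sum => i _; case: (_ <= _).
Qed.

Lemma count_thresholds_ge (k : nat) (y : R) : y <= k%:R ->
  y - 1 <= (\sum_(j < k) (j.+1%:R <= y)%R)%N%:R.
Proof.
move=> yk.
have Hk : forall k, k%:R <= y -> (\sum_(j < k) (j.+1%:R <= y)%R)%N = k.
  move=> n ny; rewrite (eq_bigr (fun=> 1%N)) ?sum1_card ?card_ord// => i _.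
  by rewrite (le_trans _ ny)// ler_nat.
have {yk} : y - 1 <= k%:R by lra.
elim: k => [|k IH] yk; first by rewrite big_ord0.
rewrite big_ord_recr/=; have [ky|] := boolP (k.+1%:R <= y).
  by rewrite Hk ?addn1// (le_trans _ ky)// ler_nat.
by rewrite addn0 -ltNge => yk1; apply: IH; rewrite -natr1 in yk1; lra.
Qed.

(** Compares sums through their level sets. Replacing the integral over the level
theta by the average over theta = 1/k, ..., k/k changes each term by at most
1/k, and k is arbitrary. *)
Lemma layer_cake_le (S T U : {fset int}) (f g h : int -> R) :
  (forall s, s \in S -> f s <= 1) -> (forall t, t \in T -> g t <= 1) ->
  (forall u, u \in U -> 0 <= h u) ->
  (forall theta : R, 0 < theta <= 1 ->
    (#|` [fset s in S | (theta <= f s)%R]%fset| + #|` [fset t in T | (theta <= g t)%R]%fset| <=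
     #|` [fset u in U | (theta <= h u)%R]%fset|)%N) ->
  \sum_(s <- S) f s + \sum_(t <- T) g t <= \sum_(u <- U) h u.
Proof.
move=> f1 g1 h0 lev.
rewrite leNgt; apply/negP => gap.
pose e := \sum_(s <- S) f s + \sum_(t <- T) g t - \sum_(u <- U) h u.
have e0 : 0 < e by rewrite /e subr_gt0.
have := truncnS_gt ((#|` S| + #|` T|)%:R / e).
set k := (Num.trunc _).+1 => kP.
have k0 : 0 < (k%:R : R) by rewrite ltr0n.
rewrite ltr_pdivrMr// in kP.
have swap (X : {fset int}) (F : int -> R) :
  (\sum_(j < k) #|` [fset x in X | (j.+1%:R / k%:R <= F x)%R]%fset| =
   \sum_(x <- X) \sum_(j < k) (j.+1%:R <= k%:R * F x)%R)%N.
  rewrite exchange_big/=; apply: eq_bigr => j _.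
  by rewrite card_fsep; apply: eq_bigr => x _; rewrite ler_pdivrMr// mulrC.
have lower (X : {fset int}) (F : int -> R) : (forall x, x \in X -> F x <= 1) ->
  k%:R * \sum_(x <- X) F x - #|` X|%:R <=
   (\sum_(j < k) #|` [fset x in X | (j.+1%:R / k%:R <= F x)%R]%fset|)%N%:R.
  move=> F1; rewrite swap (card_fset_sum1 X) !natr_sum mulr_sumr -sumrB.
  rewrite big_seq [leRHS]big_seq; apply: ler_sum => x xX.
  by apply: count_thresholds_ge; rewrite -[leRHS]mulr1 ler_pM2l// F1.
have upper : (\sum_(j < k) #|` [fset x in U | (j.+1%:R / k%:R <= h x)%R]%fset|)%N%:R
   <= k%:R * \sum_(u <- U) h u.
  rewrite swap natr_sum mulr_sumr.
  rewrite big_seq [leRHS]big_seq; apply: ler_sum => x xX.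
  by apply: count_thresholds_le; rewrite mulr_ge0 ?h0 ?ltW.
have fS := lower S f f1; have gT := lower T g g1.
have : (\sum_(j < k) #|` [fset x in S | (j.+1%:R / k%:R <= f x)%R]%fset| +
        \sum_(j < k) #|` [fset x in T | (j.+1%:R / k%:R <= g x)%R]%fset| <=
        \sum_(j < k) #|` [fset x in U | (j.+1%:R / k%:R <= h x)%R]%fset|)%N.
  rewrite -big_split/=; apply: leq_sum => j _; apply: lev.
  by rewrite divr_gt0// ler_pdivrMr// mul1r ler_nat/=.
rewrite -(ler_nat R) natrD => sums.
have : k%:R * e <= (#|` S| + #|` T|)%:R.
  by rewrite /e natrD !mulrBr mulrDr; lra.
by rewrite leNgt kP.
Qed.

(** Brunn-Minkowski in dimension d, with C in the role of the cube {0, 1}^d. The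
numbers a and b stand for the roots |A|^(1/d) and |B|^(1/d); taking them as
parameters keeps real powers out of the induction. *)
Definition brunn_minkowski (V : zmodType) (C : {fset V}) (d : nat) :=
  forall (A B : {fset V}) (a b : R), A != fset0 -> B != fset0 ->
    0 <= a -> 0 <= b -> a ^+ d <= #|` A|%:R -> b ^+ d <= #|` B|%:R ->
    (a + b) ^+ d <= #|` sumset (sumset A B) C|%:R.

Lemma exists_fset_max (T : choiceType) (d : Order.disp_t) (D : orderType d)
    (f : T -> D) (A : {fset T}) : A != fset0 ->
  exists2 m, m \in A & forall x, x \in A -> (f x <= f m)%O.
Proof.
move=> A0; have [x0 x0A] := fset0Pn _ A0.
have [m _ mP] := @arg_maxP _ _ A [` x0A]%fset predT (fun x => f (val x)) isT.
by exists (val m) => [|x xA]; [exact: valP|exact: (mP [` xA]%fset)].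
Qed.

(** With m the maximum of A and -n the minimum of B, the sets A - n and B + m + 1
lie on both sides of m - n + 1/2. The summand 1 makes up for the well-known
|A + B| >= |A| + |B| - 1. *)
Lemma sumset_int_ge (A B : {fset int}) : A != fset0 -> B != fset0 ->
  (#|` A| + #|` B| <= #|` sumset (sumset A B) [fset 0%R; 1%R]%fset|)%N.
Proof.
move=> A0 B0; have [m mA mP] := exists_fset_max id A0.
have B0' : oppset B != fset0.
  by rewrite -cardfs_gt0 card_oppset cardfs_gt0.
have [n] := exists_fset_max id B0'; rewrite mem_oppset => nB nP.
have {}nP x : x \in B -> - n <= x.
  by move=> xB; rewrite lerNl nP// mem_oppset opprK.
pose X := translate (- n) A; pose Y := translate (m + 1) B.
rewrite -(card_translate (- n) A) -(card_translate (m + 1) B) -/X -/Y.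
have XY : (X `&` Y = fset0)%fset.
  apply/fsetP => x; rewrite !inE !mem_translate; apply/negP => /andP[/mP xA /nP xB].
  by lia.
rewrite -cardfsUI XY cardfs0 addn0; apply/fsubset_leq_card/fsubsetP => x.
rewrite inE !mem_translate => /orP[xA|xB].
  rewrite -(addr0 x) -(subrK (- n) x); apply: mem_sumset; last by rewrite !inE.
  exact: mem_sumset.
have -> : x = m + (x - (m + 1)) + 1 by ring.
apply: mem_sumset; last by rewrite !inE.
exact: mem_sumset.
Qed.

Lemma brunn_minkowski_int : brunn_minkowski [fset 0%R; 1%R : int]%fset 1.
Proof.
move=> A B a b A0 B0 a0 b0; rewrite !expr1 => aA bB.
by rewrite (le_trans (lerD aA bB))// -natrD ler_nat sumset_int_ge.
Qed.

Section ProductStep.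
Variable V : zmodType.
Implicit Types A B : {fset int * V}.

Definition slice A (s : int) : {fset V} :=
  [fset p.2 | p in [fset p in A | p.1 == s]]%fset.

Definition heights A : {fset int} := [fset p.1 | p in A]%fset.

Lemma mem_slice A s v : (v \in slice A s) = ((s, v) \in A).
Proof.
apply/imfsetP/idP => [[[t w] /=]|sA].
  by rewrite !inE/= => /andP[wA /eqP <-] ->.
by exists (s, v) => //; rewrite !inE/= sA eqxx.
Qed.

Lemma mem_heights A s v : (s, v) \in A -> s \in heights A.
Proof. by move=> sA; apply/imfsetP; exists (s, v). Qed.

Lemma card_slices A : #|` A| = (\sum_(s <- heights A) #|` slice A s|)%N.
Proof.
transitivity (\sum_(s <- heights A) #|` [fset p in A | p.1 == s]%fset|)%N.
  rewrite -(double_count A (heights A) (fun p s => p.1 == s)) card_fset_sum1.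
  rewrite big_seq [RHS]big_seq; apply: eq_bigr => -[s v] pA.
  rewrite -(cardfs1 s); congr #|` _|; apply/fsetP => t; rewrite !inE/=.
  rewrite [s == t]eq_sym; case: (t =P s) => [->|_]; rewrite ?andbF// andbT.
  by rewrite (mem_heights pA).
apply: eq_bigr => s _; apply/esym/card_in_imfset => -[t v] [t' v'] /=.
by rewrite !inE/= => /andP[_ /eqP ->] /andP[_ /eqP ->] ->.
Qed.

(** The induction on the dimension in the style of Kneser and Suss. Divide the
sizes of the horizontal slices of A and B by their maxima M^n and N^n. If the
slices at heights s and t both have relative size at least theta = tau^n, the
inequality in V gives slices of relative size at least theta, with respect to
(M + N)^n, at the heights s + t and s + t + 1 of the sum; so the level sets
satisfy the one-dimensional inequality and [layer_cake_le] bounds |A|/M^n +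
|B|/N^n. The mean inequality [power_mean_le] turns this into the claim. *)
Lemma brunn_minkowski_prod (C : {fset V}) (n : nat) : (0 < n)%N ->
  brunn_minkowski C n ->
  brunn_minkowski
    [fset ((e, c) : (int * V)%type) | e in [fset 0%R; 1%R : int]%fset, c in C]%fset
    n.+1.
Proof.
move=> n0 BM A B a b A0 B0 a0 b0 aA bB.
set C' := (X in sumset _ X); set D := sumset _ _.
have max_slice (X : {fset int * V}) : X != fset0 ->
    exists2 M : R, 0 < M & (exists2 s, s \in heights X & #|` slice X s|%:R = M ^+ n) /\
      forall s, s \in heights X -> #|` slice X s|%:R <= M ^+ n.
  move=> X0; have [[x0 v0] x0X] := fset0Pn _ X0.
  have [|s sX smax] := @exists_fset_max _ _ _ (fun s => #|` slice X s|) (heights X).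
    by apply/fset0Pn; exists x0; exact: mem_heights x0X.
  have [M M0 ME] := @exists_root n #|` slice X s|%:R n0 (ler0n _ _).
  exists M; last first.
    by split; [exists s|move=> t tX; rewrite ME ler_nat; exact: smax].
  rewrite lt_neqAle M0 andbT; apply/eqP => MZ; move: ME; rewrite -MZ.
  rewrite expr0n gtn_eqF//= => /esym/eqP; rewrite pnatr_eq0 => /eqP sl0.
  have := smax _ (mem_heights x0X); rewrite sl0 leEnat leqn0 cardfs_eq0.
  by move=> /eqP /fsetP /(_ v0); rewrite mem_slice x0X inE.
have [M M0 [[sA sAA sAM] MA]] := max_slice A A0.
have [N N0 [[sB sBB sBN] NB]] := max_slice B B0.
have MN : 0 < M + N by rewrite addr_gt0.
have key : #|` A|%:R / M ^+ n + #|` B|%:R / N ^+ n <= #|` D|%:R / (M + N) ^+ n.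
  rewrite (card_slices A) (card_slices B) (card_slices D) !natr_sum !mulr_suml.
  apply: layer_cake_le.
  - by move=> s sA'; rewrite ler_pdivrMr ?exprn_gt0// mul1r MA.
  - by move=> s sB'; rewrite ler_pdivrMr ?exprn_gt0// mul1r NB.
  - by move=> s _; rewrite divr_ge0// exprn_ge0// ltW.
  move=> th /andP[th0 th1].
  set S := [fset s in heights A | _]%fset; set T := [fset s in heights B | _]%fset.
  have S0 : S != fset0.
    apply/fset0Pn; exists sA; rewrite !inE/= sAA sAM divff ?th1//.
    by rewrite expf_neq0 ?gt_eqF.
  have T0 : T != fset0.
    apply/fset0Pn; exists sB; rewrite !inE/= sBB sBN divff ?th1//.
    by rewrite expf_neq0 ?gt_eqF.
  apply: leq_trans (sumset_int_ge S0 T0) _.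
  apply/fsubset_leq_card/fsubsetP => _ /sumsetP[_ /sumsetP[s sS [t tT ->]] [e e01 ->]].
  have [tau tau0 tauE] := @exists_root n th n0 (ltW th0).
  have th_gt0 (x : R) (k : nat) : 0 < x -> th <= k%:R / x -> (0 < k)%N.
    move=> x0; rewrite ler_pdivlMr// => /(lt_le_trans _) H.
    by rewrite -(ltr_nat R) H// mulr_gt0.
  move: sS tT; rewrite !inE/= => /andP[sA' sS] /andP[tB' tT].
  have sub : (sumset (sumset (slice A s) (slice B t)) C `<=` slice D (s + t + e))%fset.
    apply/fsubsetP => _ /sumsetP[_ /sumsetP[x xs [y yt ->]] [c cC ->]].
    rewrite !mem_slice in xs yt *.
    have -> : (s + t + e, x + y + c) = ((s, x) + (t, y)) + (e, c) by [].
    apply: mem_sumset; first exact: mem_sumset.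
    by apply/imfset2P; exists e => //; exists c.
  have : (tau * M + tau * N) ^+ n <= #|` slice D (s + t + e)|%:R.
    apply: (@le_trans _ _ #|` sumset (sumset (slice A s) (slice B t)) C|%:R); last first.
      by rewrite ler_nat fsubset_leq_card.
    apply: BM.
    + by rewrite -cardfs_gt0; apply: (th_gt0 _ _ _ sS); rewrite exprn_gt0.
    + by rewrite -cardfs_gt0; apply: (th_gt0 _ _ _ tT); rewrite exprn_gt0.
    + by rewrite mulr_ge0// ltW.
    + by rewrite mulr_ge0// ltW.
    + by rewrite exprMn tauE -ler_pdivlMr// exprn_gt0.
    + by rewrite exprMn tauE -ler_pdivlMr// exprn_gt0.
  rewrite -mulrDr exprMn tauE -ler_pdivlMr ?exprn_gt0// => H.
  rewrite H andbT.
  have : (0 < #|` slice D (s + t + e)|)%N.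
    by apply: (th_gt0 _ _ _ H); rewrite exprn_gt0.
  by rewrite cardfs_gt0 => /fset0Pn[v]; rewrite mem_slice => /mem_heights.
rewrite ler_pdivlMr ?exprn_gt0// in key.
apply: le_trans key.
have -> : a + b = M * (a / M) + N * (b / N).
  by rewrite [M * _]mulrC [N * _]mulrC !divfK ?gt_eqF.
apply: le_trans (power_mean_le _ M0 N0 _ _) _; rewrite ?divr_ge0 ?(ltW M0) ?(ltW N0)//.
rewrite mulrC ler_wpM2r ?exprn_ge0 ?(ltW MN)//.
have cancel (x y : R) : 0 < x -> x * (y / x) ^+ n.+1 = y ^+ n.+1 / x ^+ n.
  move=> x0; rewrite expr_div_n [x ^+ n.+1]exprS invfM mulrCA.
  by rewrite [x * (_ * _)]mulrA divff ?gt_eqF// mul1r.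
by rewrite !cancel// lerD// ler_wpM2r// invr_ge0 exprn_ge0// ltW.
Qed.

End ProductStep.

(** Transfers the inequality along an injection, so that 'rV_(n+1) can be treated
as int * 'rV_n. *)
Lemma brunn_minkowski_inj (V W : zmodType) (f : {additive V -> W})
    (C : {fset V}) (D : {fset W}) (n : nat) :
  injective f -> (D `<=` [fset f x | x in C])%fset ->
  brunn_minkowski D n -> brunn_minkowski C n.
Proof.
move=> fI DC BM A B a b A0 B0 a0 b0 aA bB.
have ne (X : {fset V}) : X != fset0 -> [fset f x | x in X]%fset != fset0.
  by rewrite -!cardfs_gt0 card_imfset.
apply: le_trans (BM _ _ a b (ne _ A0) (ne _ B0) a0 b0 _ _) _; rewrite ?card_imfset//.
have <- : #|` [fset f x | x in sumset (sumset A B) C]%fset| = #|` sumset (sumset A B) C|.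
  by rewrite card_imfset.
rewrite ler_nat; apply/fsubset_leq_card/fsubsetP.
move=> z /sumsetP[w /sumsetP[u /imfsetP[x /= xA ->] [v /imfsetP[y /= yB ->] ->]] [d]].
move=> /(fsubsetP DC) /imfsetP[c /= cC ->] ->; rewrite -!raddfD.
by apply/imfsetP; exists (x + y + c) => //=; rewrite !mem_sumset.
Qed.

End BrunnMinkowski.

Definition box (d m : nat) : {fset 'rV[int]_d} :=
  [fset \row_i (f i : nat)%:Z | f : {ffun 'I_d -> 'I_m} in predT]%fset.

Lemma card_box d m : #|` box d m| = (m ^ d)%N.
Proof.
rewrite card_imfset /= => [|f g /rowP fg].
  by rewrite -cardE card_ffun !card_ord.
by apply/ffunP => i; have := fg i; rewrite !mxE => -[] /val_inj.
Qed.

Lemma boxP d m (z : 'rV[int]_d) :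
  reflect (forall i, 0 <= z 0 i < m%:Z) (z \in box d m).
Proof.
apply: (iffP idP) => [/imfsetP[f _ ->] i|zm]; first by rewrite mxE/= ltz_nat ltn_ord.
have zi i : (`|z 0%R i|%N < m)%N by have := zm i; lia.
apply/imfsetP; exists [ffun i => Ordinal (zi i)] => //.
by apply/rowP => i; rewrite mxE ffunE/=; have := zm i; lia.
Qed.

Lemma brunn_minkowski_rV (R : realType) (d : nat) : (0 < d)%N ->
  brunn_minkowski R (box d 2) d.
Proof.
case: d => // d _; elim: d => [|d IH].
  pose f (z : 'rV[int]_1) : int := z 0 0.
  have fadd : additive f by move=> x y; rewrite /f !mxE.
  pose F : {additive 'rV[int]_1 -> int} :=
    HB.pack f (GRing.isZmodMorphism.Build _ _ f fadd).
  apply: (@brunn_minkowski_inj R _ _ F _ _ _ _ _ (@brunn_minkowski_int R)).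
    by move=> x y xy; apply/rowP => i; rewrite !ord1.
  apply/fsubsetP => x; rewrite !inE => x01; apply/imfsetP; exists (\row_i x).
    by apply/boxP => i; rewrite mxE; case/orP: x01 => /eqP ->.
  by rewrite /= /f mxE.
pose f (z : 'rV[int]_d.+2) : int * 'rV[int]_d.+1 := (z 0 0, \row_i z 0 (lift ord0 i)).
have fadd : additive f.
  by move=> x y; rewrite /f; congr (_, _); [rewrite !mxE|apply/rowP => i; rewrite !mxE].
pose F : {additive 'rV[int]_d.+2 -> int * 'rV[int]_d.+1} :=
    HB.pack f (GRing.isZmodMorphism.Build _ _ f fadd).
apply: (@brunn_minkowski_inj R _ _ F _ _ _ _ _ (@brunn_minkowski_prod R _ _ _ _ IH)) => //.
  move=> x y [xy0 /rowP xy]; apply/rowP => i.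
  by case: (unliftP ord0 i) => [j ->|-> //]; have := xy j; rewrite !mxE.
apply/fsubsetP => _ /imfset2P[e /= e01 [c /= /boxP cB ->]].
(* the vector with first entry e and remaining entries c *)
pose z : 'rV[int]_d.+2 := \row_i (if unlift ord0 i is Some j then c 0 j else e).
have zE : f z = (e, c).
  rewrite /f mxE unlift_none; congr (_, _); apply/rowP => i.
  by rewrite !mxE liftK.
apply/imfsetP; exists z => //=; apply/boxP => i; rewrite mxE.
case: (unliftP ord0 i) => [j _|_]; first exact: cB.
by move: e01; rewrite !inE => /orP[] /eqP ->.
Qed.

(** * Integer points of dilated convex sets *)

Section Grids.
Context {R : realType} {d : nat}.
Implicit Types (K : set 'rV[R]_d) (z : 'rV[int]_d) (x y : 'rV[R]_d).

(** Bounded convex sets with 0 in the interior, described by coordinates; this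
class is stable under [minkdiff]. *)
Record solid K : Prop := Solid {
  solid_convex : forall x y t, 0 <= t <= 1 -> K x -> K y ->
    K (t *: x + (1 - t) *: y);
  solid_inner : exists2 r : R, 0 < r & forall x, (forall i, `|x 0 i| <= r) -> K x;
  solid_outer : exists M : R, forall x, K x -> forall i, `|x 0 i| <= M }.

Lemma solid0 K : solid K -> K 0.
Proof. by case=> _ [r r0 rK] _; apply: rK => i; rewrite mxE normr0 ltW. Qed.

Lemma solid_add K x y (a b : R) : solid K -> 0 <= a -> 0 <= b -> K x -> K y ->
  exists2 z, K z & a *: x + b *: y = (a + b) *: z.
Proof.
move=> sK a0 b0 Kx Ky; have [ab0|ab0] := eqVneq (a + b) 0.
  have [-> ->] : a = 0 /\ b = 0 by lra.
  by exists x; rewrite // addr0 !scale0r addr0.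
have ab : 0 < a + b by rewrite lt_neqAle eq_sym ab0 addr_ge0.
exists ((a / (a + b)) *: x + (1 - a / (a + b)) *: y).
  apply: solid_convex => //; apply/andP; split; first by rewrite divr_ge0// ltW.
  by rewrite ler_pdivrMr// mul1r; lra.
rewrite scalerDr !scalerA; congr (_ *: _ + _ *: _); first by rewrite mulrC divfK.
by rewrite mulrBr mulr1 [_ * (_ / _)]mulrC divfK//; ring.
Qed.

Lemma solid_widen K x (a b : R) : solid K -> 0 <= a <= b -> K x ->
  exists2 z, K z & a *: x = b *: z.
Proof.
move=> sK /andP[a0 ab] Kx.
have [|z Kz E] := @solid_add K x 0 a (b - a) sK a0 _ Kx (solid0 sK); first by lra.
by exists z => //; rewrite -[LHS]addr0 -(scaler0 _ (b - a)) E; congr (_ *: _); ring.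
Qed.

(** Used to absorb rounding: a vector with entries at most a belongs to (c a) K. *)
Lemma solid_cube K : solid K -> exists2 c : R, 0 < c & forall (a : R) (e : 'rV[R]_d), 0 <= a ->
  (forall i, `|e 0 i| <= a) -> exists2 x, K x & e = (c * a) *: x.
Proof.
move=> sK; case: (solid_inner sK) => r r0 rK; exists r^-1; rewrite ?invr_gt0//.
move=> a e; rewrite le_eqVlt => /predU1P[<-|a0] ea.
  exists 0; first exact: solid0.
  by rewrite scaler0; apply/rowP => i; apply/eqP; rewrite mxE -normr_le0.
exists ((r / a) *: e); last first.
  by rewrite scalerA [_ * (r / a)](_ : _ = 1) ?scale1r//; field; rewrite !gt_eqF.
apply: rK => i; rewrite mxE normrM gtr0_norm ?divr_gt0//.
by rewrite mulrAC ler_pdivrMr// ler_pM2l.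
Qed.

Definition emb z : 'rV[R]_d := map_mx intr z.

Lemma embD z w : emb (z + w) = emb z + emb w.
Proof. exact: map_mxD. Qed.
Lemma embN z : emb (- z) = - emb z.
Proof. exact: map_mxN. Qed.
Lemma embMn z n : emb (z *+ n) = n%:R *: emb z.
Proof. by rewrite /emb raddfMn scaler_nat. Qed.

Definition grid K (s : R) : {fset 'rV[int]_d} :=
  fset_set [set z | exists2 x, K x & emb z = s *: x].

Lemma grid_bounded K (M s : R) : (forall x, K x -> forall i, `|x 0 i| <= M) ->
  0 <= M -> 0 <= s ->
  [set z | exists2 x, K x & emb z = s *: x] `<=`
  [set` translate (\row__ - (Num.trunc (s * M)).+1%:Z)
          (box d ((Num.trunc (s * M)).*2.+3))].
Proof.
move=> KM M0 s0 z [x Kx /rowP E]; rewrite /= mem_translate; apply/boxP => i.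
have sM : 0 <= s * M by rewrite mulr_ge0.
have /andP[_ mM] := truncn_itv sM.
have : `|(z 0 i)%:~R| <= s * M.
  have := E i; rewrite !mxE => ->; rewrite normrM ger0_norm// ler_wpM2l//.
  exact: KM.
rewrite ler_norml => /andP[l u].
set m := Num.trunc _ in mM *.
have {}u : z 0 i < m.+1%:Z by rewrite -(ltr_int R) (le_lt_trans u).
have {}l : - m.+1%:Z < z 0 i.
  by rewrite -(ltr_int R) mulrNz; apply: lt_le_trans l; rewrite ltrN2.
clearbody m; rewrite !mxE; move: (z 0 i) u l => w u l; lia.
Qed.

Lemma gridP K s z : solid K -> 0 <= s ->
  reflect (exists2 x, K x & emb z = s *: x) (z \in grid K s).
Proof.
move=> sK s0.
have fin : finite_set [set z | exists2 x, K x & emb z = s *: x].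
  case: (solid_outer sK) => M KM.
  apply: finite_subfset; apply: (@grid_bounded _ `|M|) => // x Kx i.
  exact: le_trans (KM x Kx i) (ler_norm M).
by rewrite in_fset_set//; apply: (iffP idP); rewrite inE.
Qed.

(** A crude bound, which makes the supremum defining the volume finite. *)
Lemma card_grid_le K : solid K -> exists B : R, 0 < B /\
  forall s : R, 0 <= s -> #|` grid K s|%:R <= (B * (s + 1)) ^+ d.
Proof.
move=> sK; case: (solid_outer sK) => M0 KM0.
pose M := `|M0|; have M_ge0 : 0 <= M by exact: normr_ge0.
have KM x : K x -> forall i, `|x 0 i| <= M.
  by move=> Kx i; exact: le_trans (KM0 x Kx i) (ler_norm M0).
exists (M * 2 + 3); split=> [|s s0]; first by rewrite ltr_wpDl ?mulr_ge0.
set t := Num.trunc (s * M); have tM : t%:R <= s * M by rewrite truncn_le mulr_ge0.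
apply: (@le_trans _ _ ((t.*2.+3 ^ d)%:R)).
  rewrite ler_nat -(card_box d) -(card_translate (\row__ - t.+1%:Z) (box _ _)).
  apply/fsubset_leq_card/fsubsetP => z /(gridP _ sK s0) zK.
  exact: (grid_bounded KM).
rewrite natrX lerXn2r ?nnegrE//.
  by rewrite mulr_ge0 ?addr_ge0 ?mulr_ge0.
by rewrite -!natr1 -muln2 natrM; nra.
Qed.

Lemma grid_add K z w (a b : R) : solid K -> 0 <= a -> 0 <= b ->
  z \in grid K a -> w \in grid K b -> z + w \in grid K (a + b).
Proof.
move=> sK a0 b0 /(gridP _ sK a0)[x Kx zx] /(gridP _ sK b0)[y Ky wy].
apply/(gridP _ sK); first exact: addr_ge0.
by have [u Ku E] := solid_add sK a0 b0 Kx Ky; exists u; rewrite // embD zx wy E.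
Qed.

Lemma grid_mono K (a b : R) : solid K -> 0 <= a <= b ->
  (grid K a `<=` grid K b)%fset.
Proof.
move=> sK /andP[a0 ab]; apply/fsubsetP => z /(gridP _ sK a0)[x Kx zx].
apply/(gridP _ sK); first exact: le_trans ab.
have [|y Ky E] := @solid_widen K x a b sK _ Kx; first by rewrite a0.
by exists y; rewrite // zx.
Qed.

Lemma card_grid_mono K (a b : R) : solid K -> 0 <= a <= b ->
  (#|` grid K a| <= #|` grid K b|)%N.
Proof. by move=> sK ab; apply/fsubset_leq_card/grid_mono. Qed.

Lemma card_grid_gt0 K (s : R) : solid K -> 0 <= s -> (0 < #|` grid K s|)%N.
Proof.
move=> sK s0; rewrite cardfs_gt0; apply/fset0Pn; exists 0.
apply/(gridP _ sK s0); exists 0; first exact: solid0.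
by rewrite scaler0; apply/rowP => i; rewrite !mxE.
Qed.

(** An integer point z of s K gives rise to the m^d points of m z + [0, m)^d. They
belong to m (s + c) K and determine z by division with remainder. *)
Lemma card_grid_mul K : solid K -> exists2 c : R, 0 < c & forall (s : R) (m : nat), 0 <= s ->
  (#|` grid K s| * m ^ d <= #|` grid K (m%:R * (s + c))%R|)%N.
Proof.
move=> sK; have [c c0 cK] := solid_cube sK; exists c => // s m s0.
pose F := double_count (grid K (m%:R * (s + c))) (grid K s)
  (fun w z => w - z *+ m \in box d m).
have : (\sum_(z <- grid K s) #|` box d m| <= #|` grid K (m%:R * (s + c))|)%N.
  apply: (@leq_trans (\sum_(z <- grid K s) #|` [fset w in
      grid K (m%:R * (s + c)) | (w - z *+ m)%R \in box d m]%fset|)%N).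
    rewrite big_seq [leqRHS]big_seq; apply: leq_sum => z zK.
    rewrite -(card_translate (z *+ m) (box _ _)); apply/fsubset_leq_card/fsubsetP => w.
    rewrite mem_translate !inE/= => wB; rewrite wB andbT.
    have m0 : 0 <= (m%:R : R) by [].
    have -> : w = z *+ m + (w - z *+ m) by rewrite addrC subrK.
    rewrite mulrDr; apply: grid_add => //; rewrite ?mulr_ge0 ?(ltW c0)//.
      apply/(gridP _ sK); first exact: mulr_ge0.
      move: zK => /(gridP _ sK s0)[x Kx zx].
      by exists x; rewrite // embMn zx scalerA.
    apply/(gridP _ sK); first by rewrite mulr_ge0 // ltW.
    rewrite mulrC; apply: cK => // i; move: wB => /boxP/(_ i) wB.
    rewrite mxE ler_norml -[m%:R]/(m%:Z%:~R) -mulrNz !ler_int.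
    by move: (fun_of_matrix _ _ _) wB => k; lia.
  rewrite -F card_fset_sum1.
  apply: leq_sum => w _; apply: card_fset_le1 => z z'.
  rewrite !inE/= => /andP[_ /boxP zB] /andP[_ /boxP zB'].
  apply/rowP => i; have := zB i; have := zB' i; rewrite !mxE !mulmxnE.
  move: (z 0 i) (z' 0 i) (w 0 i) => k k' l; nia.
by rewrite big_const_seq count_predT iter_addn_0 card_box mulnC.
Qed.

End Grids.

(** * Volume as a limit of integer point counts *)

Section Volume.
Context {R : realType} {d : nat}.
Implicit Types (K : set 'rV[R]_d).

Lemma cvg_affine_ratio (a b : R) : (a * s + b) / s @[s --> +oo] --> a.
Proof.
have inv0 : (s : R)^-1 @[s --> +oo] --> (0 : R).
  by apply/gtr0_cvgV0; [exact: nbhs_pinfty_gt|exact: cvg_id].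
have : a + b * s^-1 @[s --> +oo] --> a.
  rewrite -[X in _ --> X]addr0 -(mulr0 b).
  by apply: cvgD; [exact: cvg_cst|apply: cvgM => //; exact: cvg_cst].
move=> H; apply: cvg_trans H; apply: near_eq_cvg; near=> s.
have s0 : 0 < s by near: s; exact: nbhs_pinfty_gt.
by rewrite mulrDl mulfK// gt_eqF.
Unshelve. all: by end_near. Qed.

Lemma cvgX (T : Type) (F : set_system T) {FF : Filter F} (f : T -> R) (a : R) (n : nat) :
  f x @[x --> F] --> a -> f x ^+ n @[x --> F] --> a ^+ n.
Proof. by move=> fa; exact: (cvg_comp _ _ fa (@exprn_continuous R n a)). Qed.

(** The Jordan content, as a limit over finer and finer cubic lattices. *)
Definition has_volume K (v : R) :=
  #|` grid K s|%:R / s ^+ d @[s --> +oo] --> v.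

(** The limit is the supremum of psi(s) = |s K meet Z^d| / (s + c)^d. The upper
bound on the limit is clear since (s + c)/s tends to 1. For the lower one, fix
s and let T be large: by [card_grid_mul] with m close to T/(s + c), the count
at scale T is at least psi(s) (T - (s + c))^d. *)
Lemma solid_volume K : solid K -> exists2 v, 0 < v & has_volume K v.
Proof.
move=> sK; have [c c0 cK] := card_grid_mul sK.
have [B [B0 BK]] := card_grid_le sK.
pose psi (s : R) : R := #|` grid K s|%:R / (s + c) ^+ d.
pose E := [set psi s | s in [set s : R | 0 < s]].
have psi_gt0 (s : R) : 0 < s -> 0 < psi s.
  move=> s0; rewrite divr_gt0 ?exprn_gt0 ?addr_gt0//.
  by rewrite ltr0n card_grid_gt0// ltW.
have Eub : has_ubound E.
  exists ((B * (1 + c^-1)) ^+ d) => _ [s /= s0 <-].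
  rewrite ler_pdivrMr ?exprn_gt0 ?addr_gt0//.
  have [s_ge0 B_ge0 ci0] : [/\ 0 <= s, 0 <= B & 0 < c^-1].
    by rewrite invr_gt0 !ltW.
  apply: le_trans (BK s s_ge0) _; rewrite -exprMn lerXn2r ?nnegrE//.
  - by rewrite mulr_ge0 ?addr_ge0.
  - by rewrite !mulr_ge0 ?addr_ge0 ?invr_ge0 ?(ltW c0).
  - rewrite -mulrA ler_pM2l// mulrDl mul1r mulrDr mulVf ?gt_eqF//.
    by have := mulr_ge0 (ltW ci0) s_ge0; lra.
have E0 : E !=set0 by exists (psi 1); exists 1 => //=.
have psi_le (s : R) : 0 < s -> psi s <= sup E.
  by move=> s0; apply: ub_le_sup => //; exists s.
exists (sup E); first exact: lt_le_trans (psi_gt0 1 ltr01) (psi_le 1 ltr01).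
apply/cvgrPdist_le => e e0.
have [|_ [s /= s0 <-] sE] := @sup_adherent _ E e e0; first by split.
have lo : psi s * (1 - (s + c) / T) ^+ d @[T --> +oo] --> psi s * 1 ^+ d.
  apply: cvgM; first exact: cvg_cst.
  apply: cvgX; have H := @cvg_affine_ratio 1 (- (s + c)).
  apply: cvg_trans H; apply: near_eq_cvg; near=> T.
  have T0 : 0 < T by near: T; exact: nbhs_pinfty_gt.
  by rewrite mulrDl mul1r divff ?mulNr// gt_eqF.
have hi : sup E * ((1 * T + c) / T) ^+ d @[T --> +oo] --> sup E * 1 ^+ d.
  by apply: cvgM; [exact: cvg_cst|apply: cvgX; exact: cvg_affine_ratio].
rewrite expr1n mulr1 in lo hi.
near=> T.
have T0 : 0 < T by near: T; exact: nbhs_pinfty_gt.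
have Tsc : s + c < T by near: T; apply: nbhs_pinfty_gt; exact: num_real.
have lo' : sup E - e < psi s * (1 - (s + c) / T) ^+ d.
  by near: T; exact: (cvgr_gt _ lo).
have hi' : sup E * ((1 * T + c) / T) ^+ d <= sup E + e.
  by near: T; apply: (cvgr_le _ hi); lra.
have scp : 0 < s + c by lra.
have up : #|` grid K T|%:R / T ^+ d <= sup E * ((1 * T + c) / T) ^+ d.
  rewrite expr_div_n mulrA ler_wpM2r ?invr_ge0 ?exprn_ge0 ?(ltW T0)//.
  rewrite -ler_pdivrMr ?exprn_gt0 ?mul1r ?addr_gt0//; exact: psi_le.
have down : psi s * (1 - (s + c) / T) ^+ d <= #|` grid K T|%:R / T ^+ d.
  pose m := Num.trunc (T / (s + c)).
  have /andP[m1 m2] := truncn_itv (ltW (divr_gt0 T0 scp)).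
  rewrite -/m in m1 m2.
  rewrite ler_pdivlMr ?exprn_gt0// -mulrA -exprMn.
  have -> : (1 - (s + c) / T) * T = T - (s + c) by field; rewrite gt_eqF.
  apply: (@le_trans _ _ (psi s * (m%:R * (s + c)) ^+ d)).
    rewrite ler_wpM2l ?(ltW (psi_gt0 _ s0))// lerXn2r ?nnegrE//.
    - by lra.
    - by rewrite mulr_ge0// ltW.
    - by rewrite -natr1 ltr_pdivrMr// mulrDl mul1r in m2; lra.
  rewrite exprMn mulrC -mulrA [_ * psi s]mulrC /psi divfK ?expf_neq0 ?gt_eqF//.
  rewrite mulrC -natrX -natrM ler_nat (leq_trans (cK s m (ltW s0)))//.
  apply: card_grid_mono => //; rewrite mulr_ge0 ?(ltW scp)//=.
  by rewrite -ler_pdivlMr.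
by rewrite ler_distl; apply/andP; split; lra.
Unshelve. all: by end_near. Qed.

(** Homogeneity of the volume, together with the insensitivity of the limit to a
bounded change b of the scale. *)
Lemma volume_affine K v (a b : R) : has_volume K v -> 0 < a ->
  #|` grid K (a * s + b)|%:R / s ^+ d @[s --> +oo] --> a ^+ d * v.
Proof.
move=> vK a0; have ab : a * s + b @[s --> +oo] --> +oo.
  apply: (@cvg_comp _ _ _ (fun s => a * s) (fun t => t + b) _ +oo).
    by apply: gt0_cvgMry => //; exact: cvg_id.
  exact: cvg_addrr.
have H : (#|` grid K (a * s + b)|%:R / (a * s + b) ^+ d) *
    ((a * s + b) / s) ^+ d @[s --> +oo] --> v * a ^+ d.
  apply: cvgM; last by apply: cvgX; exact: cvg_affine_ratio.
  exact: (cvg_comp _ _ ab vK).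
rewrite mulrC; apply: cvg_trans H; apply: near_eq_cvg; near=> s.
have s0 : a * s + b != 0.
  rewrite gt_eqF//; near: s.
  have := ab; move/cvgryPgt/(_ 0); exact.
by rewrite expr_div_n mulrA divfK// expf_neq0.
Unshelve. all: by end_near. Qed.

End Volume.

(** * A binomial lower bound for a Beta sum *)

Section Binomials.
Local Open Scope nat_scope.

(** Sorts the (a+b+1)-element subsets of n points by the position j of their element
of rank a. *)
Lemma sum_bin_mul (n a b : nat) :
  \sum_(j < n) 'C(j, a) * 'C(n.-1 - j, b) = 'C(n, a + b.+1).
Proof.
elim: n b => [|n IH] b; first by rewrite big_ord0 addnS bin0n.
elim: b => [|b _].
  rewrite big_ord_recr/= bin0 muln1 addn1 binS; congr (_ + _).
  rewrite -[in RHS]addn1 -(IH 0); apply: eq_bigr => i _.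
  by rewrite !bin0.
rewrite big_ord_recr/= subnn bin0n muln0 addn0 !addnS binS -!addnS -!IH.
rewrite -big_split/=; apply: eq_bigr => i _; rewrite -mulnDr.
have -> : n - i = (n.-1 - i).+1 by move: (nat_of_ord i) (ltn_ord i) => j; lia.
by rewrite binS.
Qed.

Lemma ffact_le_exp (n m : nat) : n ^_ m <= n ^ m.
Proof.
elim: m => // m IH; rewrite ffactnSr expnSr leq_mul//; exact: leq_subr.
Qed.

Lemma exp_le_ffact (n m : nat) : (n - m) ^ m <= n ^_ m.
Proof.
elim: m n => // m IH n; rewrite ffactnS expnS; apply: leq_mul; first exact: leq_subr.
by have -> : n - m.+1 = n.-1 - m by lia.
Qed.

Lemma power_gap_ge (j n : nat) : (n.+1)`! * 'C(j, n) <= j.+1 ^ n.+1 - j ^ n.+1.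
Proof.
rewrite factS -mulnA [n`! * _]mulnC bin_ffact.
apply: (@leq_trans (n.+1 * j ^ n)); first by rewrite leq_mul2l ffact_le_exp orbT.
rewrite leq_subRL ?leq_exp2r//.
elim: n => [|n IH]; first by rewrite !expn1 expn0 muln1 addn1.
rewrite [j.+1 ^ _]expnS; apply: leq_trans (leq_mul (leqnn j.+1) IH).
rewrite !expnS; nia.
Qed.

(** The sum is k^(2d) times a Riemann sum for the integral of d r^(d-1) (1-r)^d
over [0, 1], which is 1/'C(2d, d). Bounding powers below by falling factorials
turns it into the exact convolution [sum_bin_mul] of binomials. *)
Lemma sum_power_gaps_ge (k d : nat) : 0 < d ->
  d`! * d`! * (k - 2 * d) ^ (2 * d) <=
  (2 * d)`! * \sum_(j < k) (j.+1 ^ d - j ^ d) * (k.-1 - j) ^ d.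
Proof.
case: d => // n _; set d := n.+1.
have -> : 2 * d = n + d.+1 by rewrite /d; lia.
apply: (@leq_trans ((n + d.+1)`! * (d`! * d`! * 'C(k, n + d.+1)))).
  rewrite mulnCA leq_mul2l orbC [_`! * 'C(_, _)]mulnC bin_ffact.
  by rewrite exp_le_ffact.
rewrite leq_mul2l -sum_bin_mul big_distrr/=; apply/orP; right.
apply: leq_sum => j _; rewrite mulnACA leq_mul ?power_gap_ge//.
by rewrite mulnC bin_ffact ffact_le_exp.
Qed.
End Binomials.

(** * The bodies K - l K and the Brunn-Minkowski inequality *)

Lemma box2_entry d (z : 'rV[int]_d) i : z \in box d 2 ->
  (z 0 i == 0) || (z 0 i == 1).
Proof. by move=> /boxP/(_ i); move: (z 0 i) => k; lia. Qed.

Section Differences.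
Context {R : realType} {d : nat}.
Implicit Types (K : set 'rV[R]_d) (l : R).

(** The Minkowski sum of K and -l K, as opposed to the erosion of K by l K. *)
Definition minkdiff K l : set 'rV[R]_d := [set x - l *: y | x in K & y in K].

Lemma solid_minkdiff K l : 0 <= l -> solid K -> solid (minkdiff K l).
Proof.
move=> l0 sK; split.
- move=> _ _ t t01 [x Kx [x' Kx' <-]] [y Ky [y' Ky' <-]].
  exists (t *: x + (1 - t) *: y); first exact: solid_convex.
  exists (t *: x' + (1 - t) *: y'); first exact: solid_convex.
  by apply/rowP => i; rewrite !mxE; ring.
- have [r r0 rK] := solid_inner sK; exists r => // x xr.
  exists x; first exact: rK.
  by exists 0; [exact: solid0|rewrite scaler0 subr0].
- have [M KM] := solid_outer sK; exists (M + l * M) => _ [x Kx [y Ky <-]] i.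
  rewrite !mxE; apply: le_trans (ler_normB _ _) _; rewrite lerD ?KM//.
  by rewrite normrM (ger0_norm l0) ler_wpM2l ?KM.
Qed.

(** By convexity l K + (1 - l) K = K, hence K - K contains (K - l K) - (1 - l) K.
The finite inequality is applied to the integer points of s (K - l K) and of
-s (1 - l) K; the extra cube {0, 1}^d costs a bounded change of scale. *)
Lemma volume_brunn_minkowski K l v e w p q r : (0 < d)%N -> solid K -> 0 <= l < 1 ->
  has_volume K v -> has_volume (minkdiff K l) e -> has_volume (minkdiff K 1) w ->
  0 < p -> 0 < q -> 0 <= r -> p ^+ d = e -> q ^+ d = v -> r ^+ d = w ->
  p + (1 - l) * q <= r.
Proof.
move=> d0 sK /andP[l0 l1] Kv Ke Kw p0 q0 r0 pe qv rw.
have sE := solid_minkdiff l0 sK; have sD := solid_minkdiff ler01 sK.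
have l10 : 0 < 1 - l by lra.
(* Shrinking p and q by tau makes the eventual lower bounds on the two counts
   strict consequences of the limits. *)
suff H tau : 0 < tau < 1 -> tau * p + (1 - l) * (tau * q) <= r.
  rewrite leNgt; apply/negP; set X := p + _ => rX.
  have X0 : 0 < X by lra.
  have := H ((X + r) / (2 * X)).
  have -> : (X + r) / (2 * X) * p + (1 - l) * ((X + r) / (2 * X) * q) = (X + r) / 2.
    by rewrite [LHS](_ : _ = (X + r) / (2 * X) * X); [field; rewrite gt_eqF|rewrite /X; ring].
  have X2 : 0 < 2 * X by rewrite mulr_gt0.
  suff -> : 0 < (X + r) / (2 * X) < 1 by move=> /(_ isT); lra.
  by rewrite divr_gt0//= ?ltr_pdivrMr//; lra.
move=> /andP[t0 t1]; set p' := tau * p; set q' := tau * q.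
have p'0 : 0 < p' by rewrite mulr_gt0.
have q'0 : 0 < q' by rewrite mulr_gt0.
have p'e : p' ^+ d < e.
  by rewrite -pe ltrXn2r ?(ltW p'0) -?lt0n// /p'; nra.
have q'v : ((1 - l) * q') ^+ d < (1 - l) ^+ d * v.
  rewrite exprMn ltr_pM2l ?exprn_gt0// -qv ltrXn2r ?(ltW q'0) -?lt0n// /q'; nra.
clearbody p' q'.
have [c c0 cD] := solid_cube sD.
have Kw' := volume_affine c Kw ltr01; rewrite expr1n mul1r in Kw'.
have Kv' := volume_affine 0 Kv l10.
have d0' : d != 0%N by rewrite -lt0n.
rewrite -(ler_pXn2r d0) ?nnegrE ?addr_ge0 ?(ltW p'0) ?mulr_ge0 ?(ltW q'0) ?(ltW l10)//.
rewrite rw.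
apply: (ler_cvg_to (cvg_cst _) Kw'); near=> s.
have s0 : 0 < s by near: s; exact: nbhs_pinfty_gt.
have Ae : p' ^+ d < #|` grid (minkdiff K l) s|%:R / s ^+ d.
  by near: s; exact: cvgr_gt Ke _ p'e.
have Bv : ((1 - l) * q') ^+ d < #|` grid K ((1 - l) * s + 0)|%:R / s ^+ d.
  by near: s; exact: cvgr_gt Kv' _ q'v.
rewrite ltr_pdivlMr ?exprn_gt0// -exprMn in Ae.
rewrite ltr_pdivlMr ?exprn_gt0// -exprMn addr0 in Bv.
have ls0 : 0 <= (1 - l) * s by rewrite mulr_ge0// ltW.
rewrite ler_pdivlMr ?exprn_gt0// -exprMn mulrDl mul1r.
apply: le_trans (@brunn_minkowski_rV R d d0 (grid (minkdiff K l) s)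
   (oppset (grid K ((1 - l) * s))) _ _ _ _ _ _ (ltW Ae) _) _.
- by rewrite -cardfs_gt0 card_grid_gt0// ltW.
- by rewrite -cardfs_gt0 card_oppset card_grid_gt0.
- by rewrite mulr_ge0// ltW.
- by apply: mulr_ge0; [exact: mulr_ge0 (ltW l10) (ltW q'0)|exact: ltW].
- by rewrite card_oppset ltW.
rewrite ler_nat; apply/fsubset_leq_card/fsubsetP => w0 /sumsetP[w1 /sumsetP[a]].
move=> /(gridP _ sE (ltW s0))[x0 [x Kx [y Ky <-]] aE] [b].
rewrite mem_oppset => /(gridP _ sK ls0)[z Kz bE] -> [u uB ->].
apply: grid_add => //; rewrite ?(ltW s0) ?(ltW c0)//.
  apply/(gridP _ sD (ltW s0)).
  have [|y' Ky' yE] := @solid_add _ _ K y z l (1 - l) sK l0 _ Ky Kz; first exact: ltW.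
  exists (x - 1 *: y'); first by exists x => //; exists y'.
  have -> : y' = l *: y + (1 - l) *: z by rewrite yE addrC subrK scale1r.
  rewrite embD -[b]opprK embN bE aE; apply/rowP => i; rewrite !mxE; ring.
apply/(gridP _ sD (ltW c0)).
rewrite -[c]mulr1; apply: cD => // i.
have /orP[] := box2_entry i uB.
- by move=> /eqP ui; rewrite mxE ui normr0.
- by move=> /eqP ui; rewrite mxE ui normr1 ?ler01.
Unshelve. all: by end_near. Qed.

(** If x = s t (a - b) with a and b in K, then the copy s (1 - t) K + s t b is
inside s K, and so is its translate by x, equal to s (1 - t) K + s t a. The
vector s t b has to be rounded to an integer vector, whence the loss c. *)
Lemma card_intersection_ge K (c s t : R) x : solid K ->
  (forall (a : R) (e : 'rV[R]_d), 0 <= a ->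
    (forall i, `|e 0 i| <= a) -> exists2 x, K x & e = (c * a) *: x) ->
  0 <= c -> 0 <= s -> 0 <= t -> 0 <= s * (1 - t) - c ->
  x \in grid (minkdiff K 1) (s * t) ->
  (#|` grid K (s * (1 - t) - c)| <=
   #|` [fset z in grid K s | (x + z)%R \in grid K s]%fset|)%N.
Proof.
move=> sK cK c0 s0 t0 g0; have sD := solid_minkdiff ler01 sK.
have st0 : 0 <= s * t by rewrite mulr_ge0.
move=> /(gridP _ sD st0)[x0 [a Ka [b Kb <-]] xE]; rewrite scale1r in xE.
pose q : 'rV[int]_d := \row_i Num.floor (s * t * b 0 i).
have [|k Kk kE] := cK 1 (emb q - (s * t) *: b) ler01.
  move=> i; rewrite !mxE ler_norml.
  have := floor_le (s * t * b 0 i); have := lt_succ_floor (s * t * b 0 i).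
  by rewrite intrD; lra.
have inK (y : 'rV[R]_d) u : K y -> u \in grid K (s * (1 - t) - c) ->
    exists2 x, K x & emb u + emb q - (s * t) *: b + (s * t) *: y = s *: x.
  move=> Ky /(gridP _ sK g0)[x' Kx' ->].
  have [y1 Ky1 E1] := solid_add sK g0 c0 Kx' Kk.
  have [y2 Ky2 E2] := solid_add sK (addr_ge0 g0 c0) st0 Ky1 Ky.
  exists y2 => //; rewrite -addrA -addrA [X in _ + X]addrA kE mulr1.
  by rewrite addrA E1 E2; congr (_ *: _); ring.
rewrite -(card_translate q (grid K _)); apply/fsubset_leq_card/fsubsetP => z.
rewrite mem_translate !inE/= => zq.
apply/andP; split; apply/(gridP _ sK s0).
  have [y Ky E] := inK b _ Kb zq; exists y => //.
  by rewrite -E -embD !subrK.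
have [y Ky E] := inK a _ Ka zq; exists y => //.
rewrite -E -embD subrK embD xE scalerBr.
by apply/rowP => i; rewrite !mxE; ring.
Qed.

(** Each pair of elements of A has only one difference. *)
Lemma sum_intersections_le (V : zmodType) (X A : {fset V}) :
  (\sum_(x <- X) #|` [fset z in A | (x + z)%R \in A]%fset| <= #|` A| * #|` A|)%N.
Proof.
rewrite (double_count X A (fun x z => (x + z)%R \in A)).
rewrite {2}(card_fset_sum1 A) big_distrr/=; apply: leq_sum => z _.
rewrite muln1 -[leqRHS](card_translate (- z)); apply/fsubset_leq_card/fsubsetP => x.
by rewrite mem_translate opprK !inE/= => /andP[].
Qed.

Lemma sum_layers_le (T : choiceType) (F : nat -> {fset T}) (f : T -> nat)
    (g : nat -> nat) (m : nat) : F 0%N = fset0 ->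
  (forall j, (F j `<=` F j.+1)%fset) ->
  (forall j x, (j < m)%N -> x \in F j.+1 -> (g j <= f x)%N) ->
  (\sum_(j < m) (#|` F j.+1| - #|` F j|) * g j <= \sum_(x <- F m) f x)%N.
Proof.
move=> F0 FS; elim: m => [|m IH] fg; first by rewrite big_ord0.
rewrite big_ord_recr/= (big_fsetID _ (mem (F m)) (F m.+1))/=.
have -> : [fset x in F m.+1 | x \in F m]%fset = F m.
  apply/fsetP => x; rewrite !inE/=; apply: andb_idl; exact: (fsubsetP (FS m)).
apply: leq_add; first by apply: IH => j x jm; apply: fg; exact: ltnW.
set Y := [fset x in _ | _]%fset.
have -> : Y = (F m.+1 `\` F m)%fset by apply/fsetP => x; rewrite !inE/= andbC.
rewrite -cardfsDS// card_fset_sum1 big_distrl/= big_seq [leqRHS]big_seq.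
apply: leq_sum => x; rewrite inE mul1n => /andP[_ xF]; exact: fg.
Qed.

End Differences.

(** * The Rogers-Shephard inequality *)

Section RogersShephard.
Context {R : realType} {d : nat}.
Implicit Types (K : set 'rV[R]_d) (l : R).

Lemma cvg_sum_ord (F : set_system R) {FF : Filter F} (n : nat) (f : nat -> R -> R)
    (l : nat -> R) : (forall j, (j < n)%N -> f j s @[s --> F] --> l j) ->
  \sum_(j < n) f j s @[s --> F] --> \sum_(j < n) l j.
Proof.
elim: n => [|n IH] fl.
  by under eq_fun do rewrite big_ord0; rewrite big_ord0; exact: cvg_cst.
under eq_fun do rewrite big_ord_recr; rewrite big_ord_recr.
by apply: cvgD; [apply: IH => j jn; apply: fl; exact: ltnW|exact: fl].
Qed.

Lemma volume_scale K v (a : R) : has_volume K v -> 0 < a ->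
  #|` grid K (s * a)|%:R / s ^+ d @[s --> +oo] --> a ^+ d * v.
Proof.
move=> Kv a0; apply: cvg_trans (volume_affine 0 Kv a0).
by apply: near_eq_cvg; apply: nearW => s; rewrite addr0 [a * s]mulrC.
Qed.

(** The integer points x of s (K - K) are sorted into n+1 concentric shells. In the
shell of index j+1, x is a difference of at least as many pairs of points of
s K as there are points in s (1 - (j+1)/(n+1)) K, up to a bounded change of scale,
and the total number of pairs is |s K|^2. The last shell contributes nothing. *)
Lemma rogers_shephard_layers K v w (n : nat) : (0 < d)%N -> solid K ->
  0 < v -> has_volume K v -> has_volume (minkdiff K 1) w ->
  w * (\sum_(j < n.+1) (j.+1 ^ d - j ^ d) * (n - j) ^ d)%N%:R <=
    v * n.+1%:R ^+ (2 * d).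
Proof.
move=> d0 sK v0 Kv Kw; have sD := solid_minkdiff ler01 sK.
rewrite big_ord_recr/= subnn exp0n// muln0 addn0.
have [c c0 cK] := solid_cube sK.
set k := n.+1; have k0 : 0 < (k%:R : R) by rewrite ltr0n.
(* The empty set at j = 0 puts the origin into the first shell. *)
pose F (s : R) (j : nat) : {fset 'rV[int]_d} :=
  if j is 0%N then fset0 else grid (minkdiff K 1) (s * (j%:R / k%:R)).
pose g (s : R) (j : nat) := #|` grid K (s * (1 - j.+1%:R / k%:R) - c)|.
have jk0 (j : nat) : 0 <= (j%:R / k%:R : R) by rewrite divr_ge0// ltW.
have compl j : (j < n)%N -> (n - j)%:R / k%:R = 1 - j.+1%:R / k%:R :> R.
  by move=> jn; rewrite -subSS natrB ?ltnS 1?ltnW// mulrBl divff ?gt_eqF.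
have FS s j : 0 <= s -> (F s j `<=` F s j.+1)%fset.
  move=> s0; case: j => [|j]; first exact: fsub0set.
  apply: grid_mono => //; rewrite mulr_ge0//= ler_wpM2l// ler_pM2r ?invr_gt0//.
  by rewrite ler_nat.
have Fcvg j : #|` F s j|%:R / s ^+ d @[s --> +oo] --> (j%:R / k%:R) ^+ d * w.
  case: j => [|j].
    rewrite mul0r expr0n gtn_eqF// mul0r.
    under eq_fun do rewrite /F cardfs0 mul0r; exact: cvg_cst.
  by apply: volume_scale => //; rewrite divr_gt0.
have gcvg j : (j < n)%N ->
    (g s j)%:R / s ^+ d @[s --> +oo] --> ((n - j)%:R / k%:R) ^+ d * v.
  move=> jn; have -> : (n - j)%:R / k%:R = 1 - j.+1%:R / k%:R :> R.
    exact: compl.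
  have a0 : 0 < 1 - j.+1%:R / k%:R :> R.
    by rewrite subr_gt0 ltr_pdivrMr// mul1r ltr_nat.
  apply: cvg_trans (volume_affine (- c) Kv a0).
  by apply: near_eq_cvg; apply: nearW => s; rewrite /g [s * _]mulrC.
have lim1 : \sum_(j < n) (#|` F s j.+1|%:R / s ^+ d - #|` F s j|%:R / s ^+ d) *
    ((g s j)%:R / s ^+ d) @[s --> +oo] -->
    \sum_(j < n) ((j.+1%:R / k%:R) ^+ d * w - (j%:R / k%:R) ^+ d * w) *
      (((n - j)%:R / k%:R) ^+ d * v).
  apply: (cvg_sum_ord (f := fun j s => (#|` F s j.+1|%:R / s ^+ d - #|` F s j|%:R / s ^+ d) *
    ((g s j)%:R / s ^+ d)) (l := fun j => ((j.+1%:R / k%:R) ^+ d * w - (j%:R / k%:R) ^+ d * w) *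
      (((n - j)%:R / k%:R) ^+ d * v))) => j jn.
  by apply: cvgM; [apply: cvgB; exact: Fcvg|exact: gcvg].
have := ler_cvg_to lim1 (cvgM Kv Kv).
have -> : \sum_(j < n) ((j.+1%:R / k%:R) ^+ d * w - (j%:R / k%:R) ^+ d * w) *
      (((n - j)%:R / k%:R) ^+ d * v) =
   v * (w * (\sum_(j < n) (j.+1 ^ d - j ^ d) * (n - j) ^ d)%N%:R) / k%:R ^+ (2 * d).
  rewrite natr_sum !mulr_sumr mulr_suml; apply: eq_bigr => j _.
  have le : (j ^ d <= j.+1 ^ d)%N by rewrite leq_exp2r.
  rewrite natrM (natrB _ le) !natrX.
  rewrite !expr_div_n mul2n -addnn exprD.
  have x0 : k%:R ^+ d != 0 :> R by rewrite expf_neq0// gt_eqF.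
  set x := _%:R ^+ d in x0 *; set y := j.+1%:R ^+ d; set z := j%:R ^+ d.
  set t := (n - j)%:R ^+ d; clearbody x y z t.
  by field.
rewrite ler_pdivrMr ?exprn_gt0// -[v * v * _]mulrA ler_pM2l//; apply.
near=> s.
have s0 : 0 < s by near: s; exact: nbhs_pinfty_gt.
have sc : c * k%:R < s by near: s; apply: nbhs_pinfty_gt; exact: num_real.
have s_ge0 := ltW s0.
have sd0 : 0 < s ^+ d by rewrite exprn_gt0.
have := @sum_layers_le _ (F s)
  (fun x => #|` [fset z in grid K s | (x + z)%R \in grid K s]%fset|) (g s) n erefl
  (fun j => FS s j s_ge0) _.
move=> /(_ _)/leq_trans/(_ (sum_intersections_le _ _)) H.
have {H} : (\sum_(j < n) (#|` F s j.+1| - #|` F s j|) * g s j <=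
    #|` grid K s| * #|` grid K s|)%N.
  apply: H => j x jn xF; apply: (card_intersection_ge sK cK) => //.
  - exact: ltW.
  - rewrite subr_ge0 -compl// mulrA ler_pdivlMr//.
    apply: le_trans (ltW sc) _; rewrite -[leLHS]mulr1 ler_pM2l//.
    by rewrite ler1n subn_gt0.
rewrite -(ler_nat R) natrM natr_sum => H.
rewrite /= mulf_div ler_pdivlMr ?mulr_gt0// mulr_suml; apply: le_trans H.
apply: ler_sum => j _; rewrite -mulrBl mulf_div divfK ?gt_eqF ?mulr_gt0//.
by rewrite natrM natrB// fsubset_leq_card// FS.
Unshelve. all: by end_near. Qed.

(** As the number n+1 of shells grows, the left side of [rogers_shephard_layers],
divided by (n+1)^(2d), tends to w times the Beta integral 1/'C(2d, d). *)
Lemma volume_rogers_shephard K v w : (0 < d)%N -> solid K ->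
  0 < v -> has_volume K v -> has_volume (minkdiff K 1) w ->
  w <= 'C(2 * d, d)%:R * v.
Proof.
move=> d0 sK v0 Kv Kw.
have w0 : 0 <= w.
  apply: (ler_cvg_to (cvg_cst _) Kw); near=> s.
  by rewrite divr_ge0// exprn_ge0//; near: s; apply: nbhs_pinfty_ge; exact: num_real.
have lim : w * ((d`! * d`!)%N%:R * ((1 * n%:R + - (2 * d)%:R) / n%:R) ^+ (2 * d))
    @[n --> \oo] --> w * ((d`! * d`!)%N%:R * 1 ^+ (2 * d)).
  apply: cvgM; first exact: cvg_cst.
  apply: cvgM; first exact: cvg_cst.
  apply: cvgX.
  exact: (cvg_comp _ _ (@cvgr_idn R) (@cvg_affine_ratio R 1 (- (2 * d)%:R))).
rewrite expr1n mulr1 in lim.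
have fact0 : 0 < ((d`! * d`!)%:R : R) by rewrite ltr0n muln_gt0 !fact_gt0.
have dd : (d <= 2 * d)%N by rewrite mul2n -addnn leq_addr.
have binE : ('C(2 * d, d) * (d`! * d`!) = (2 * d)`!)%N.
  by rewrite -[RHS](bin_fact dd) mul2n -addnn addnK.
rewrite -(ler_pM2r fact0) mulrAC -natrM binE.
apply: (ler_cvg_to lim (cvg_cst _)); near=> n.
have nd : (2 * d <= n)%N by near: n; exact: nbhs_infty_ge.
have n0 : (0 < n)%N by apply: leq_trans nd; rewrite muln_gt0.
have n0' : 0 < (n%:R : R) by rewrite ltr0n.
have := rogers_shephard_layers n.-1 d0 sK v0 Kv Kw; rewrite prednK// => H.
rewrite mul1r -natrB// expr_div_n !mulrA ler_pdivrMr ?exprn_gt0//.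
rewrite -!mulrA -(natrX _ (n - _)) -natrM.
apply: (@le_trans _ _ (w * ((2 * d)`! *
    \sum_(j < n) (j.+1 ^ d - j ^ d) * (n.-1 - j) ^ d)%N%:R)).
  by rewrite ler_wpM2l// ler_nat sum_power_gaps_ge.
by rewrite natrM mulrCA ler_wpM2l.
Unshelve. all: by end_near. Qed.

End RogersShephard.

(** * Covering a convex set by translates of a smaller copy *)

Section Covering.
Context {R : realType} {d : nat}.
Implicit Types (K : set 'rV[R]_d) (l : R).

Lemma covered_seq K l (T : seq 'rV[R]_d) :
  (forall x, K x -> exists2 t, t \in T & exists2 y, K y & x = l *: y + t) ->
  covered K l (size T).
Proof.
move=> KT; exists (fun i => T`_i) => x /KT[t tT [y Ky xE]].
have iT : (index t T < size T)%N by rewrite index_mem.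
by exists (Ordinal iT) => //; exists y; rewrite //= nth_index.
Qed.

(** Here b K is the body L of the opening comment at scale s, so that (1 + eta) b is
l s up to the loss c due to rounding; the enlarged scale s + c accounts for the
rounding of the points of s K. The packing uses a large symmetric subset Q of
the integer points of eta b K. *)
Lemma covered_by_counts K l (c eta s b : R) : solid K ->
  (forall (a : R) (e : 'rV[R]_d), 0 <= a ->
    (forall i, `|e 0 i| <= a) -> exists2 x, K x & e = (c * a) *: x) ->
  0 <= c -> 0 <= l -> 0 < eta <= 1 -> 0 < s -> 0 <= b ->
  (1 + eta) * b = l * s - c ->
  exists2 n, covered K l n &
   (n%:R : R) <= #|` grid (minkdiff K l) (s + c)|%:R / #|` grid K b|%:R *
     (ln (#|` grid K b|%:R * #|` grid K (eta * b + eta * b)|%:R /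
          #|` grid K (eta * b)|%:R ^+ 2) + 1) + 1.
Proof.
move=> sK cK c0 l0 /andP[e0 e1] s0 b0 bE.
have sE := solid_minkdiff l0 sK.
have eb0 : 0 <= eta * b by rewrite mulr_ge0// ltW.
have sc0 : 0 <= s + c by rewrite addr_ge0// ltW.
set W := grid (minkdiff K l) _; set P := grid K b; set H := grid K (eta * b).
set H2 := grid K (eta * b + eta * b).
have H0 : H != fset0 by rewrite -cardfs_gt0 card_grid_gt0.
have P0 : P != fset0 by rewrite -cardfs_gt0 card_grid_gt0.
have W0 : W != fset0 by rewrite -cardfs_gt0 card_grid_gt0.
have A0 : grid K (s + c) != fset0 by rewrite -cardfs_gt0 card_grid_gt0.
have [x0 [Q [/fsubsetP QH Qsym cQ]]] := large_symmetric_subset H0.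
have HH2 : (sumset H H `<=` H2)%fset.
  by apply/fsubsetP => _ /sumsetP[x xH [y yH ->]]; exact: grid_add.
have H_gt0 : 0 < (#|` H|%:R : R) by rewrite ltr0n cardfs_gt0.
have P_gt0 : 0 < (#|` P|%:R : R) by rewrite ltr0n cardfs_gt0.
have W_gt0 : 0 < (#|` W|%:R : R) by rewrite ltr0n cardfs_gt0.
have cQ2 : (#|` H| ^ 2 <= #|` H2| * #|` Q|)%N.
  by apply: leq_trans cQ _; rewrite leq_mul2r fsubset_leq_card ?orbT.
have : (0 < #|` H2| * #|` Q|)%N.
  by apply: leq_trans cQ2; rewrite expn_gt0 cardfs_gt0 H0.
rewrite muln_gt0 => /andP[H2_gt0]; rewrite cardfs_gt0 => Q0.
have Q_gt0 : 0 < (#|` Q|%:R : R) by rewrite ltr0n cardfs_gt0.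
set g : R := _ / _ ^+ 2; set r : R := #|` W|%:R / _.
have H2_gt0' : 0 < (#|` H2|%:R : R) by rewrite ltr0n.
have g1 : 1 <= g.
  rewrite ler_pdivlMr ?exprn_gt0// mul1r expr2 ler_pM ?ler_nat//.
    by apply: card_grid_mono; rewrite // eb0 -[leRHS]mul1r ler_wpM2r.
  by apply: card_grid_mono; rewrite // eb0 lerDl.
have r0 : 0 < r by rewrite divr_gt0.
have lng0 : 0 <= r * ln g by rewrite mulr_ge0 ?ln_ge0// ltW.
(* N > r ln g steps leave at most |W|/g points, and a packing by sets of size
   |Q| >= |P|/g then has at most r members. *)
pose N := (Num.trunc (r * ln g)).+1.
have /andP[N1 N2] := truncn_itv lng0.
(* points of (s + c) K minus points of eta b K minus points of b K lie in
   (s + c) (K - l K), because b + eta b <= l (s + c) *)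
have [|T1 [T2 [T1N T2le cov]]] := @cover_by_greedy_and_packing R _
  (grid K (s + c)) P Q W N A0 P0 Q0 W0.
  move=> z p q /(gridP _ sK sc0)[x Kx zE] /(gridP _ sK b0)[y Ky pE] /QH.
  move=> /(gridP _ sK eb0)[y' Ky' qE]; apply/(gridP _ sE sc0).
  have [u Ku uE] := solid_add sK b0 eb0 Ky Ky'.
  have [|u' Ku' u'E] := @solid_widen _ _ K u (b + eta * b) (l * (s + c)) sK _ Ku.
    rewrite addr_ge0//=.
    have -> : b + eta * b = l * s - c by rewrite -bE; ring.
    by rewrite mulrDr; have := mulr_ge0 l0 c0; lra.
  exists (x - l *: u'); first by exists x => //; exists u'.
  rewrite !embD !embN zE pE qE scalerBr scalerA -addrA -opprD [_ + b *: y]addrC.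
  by rewrite uE u'E [l * _]mulrC.
pose T := [seq s^-1 *: emb t | t <- T1 ++ [seq t - x0 | t <- T2]].
exists (size T).
  apply: covered_seq => x Kx.
  pose z : 'rV[int]_d := \row_i Num.floor (s * x 0 i).
  have fE i : 0 <= s * x 0 i - (Num.floor (s * x 0 i))%:~R <= 1.
    have := floor_le (s * x 0 i); have := lt_succ_floor (s * x 0 i).
    by rewrite intrD; lra.
  have [|k Kk kE] := cK 1 (emb z - s *: x) ler01.
    by move=> i; rewrite !mxE ler_norml; have := fE i; lra.
  have [|k' Kk' k'E] := cK 1 (s *: x - emb z) ler01.
    by move=> i; rewrite !mxE ler_norml; have := fE i; lra.
  rewrite mulr1 in kE k'E.
  have zA : z \in grid K (s + c).
    apply/(gridP _ sK sc0).
    have [y Ky yE] := solid_add sK (ltW s0) c0 Kx Kk.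
    by exists y; rewrite // -yE -kE addrC subrK.
  (* x is recovered from z at the cost of a vector of c K *)
  have fin t w : z = t + w -> w \in grid K (b + eta * b) ->
      exists2 y, K y & x = l *: y + s^-1 *: emb t.
    move=> zE /(gridP _ sK)[|y Ky wE]; first exact: addr_ge0.
    have [y' Ky' y'E] := solid_add sK (addr_ge0 b0 eb0) c0 Ky Kk'.
    exists y' => //; apply: (@scalerI _ _ s); first by rewrite gt_eqF.
    rewrite scalerDr !scalerA divff ?gt_eqF// scale1r.
    have -> : s * l = b + eta * b + c.
      have -> : b + eta * b = l * s - c by rewrite -bE; ring.
      by ring.
    by rewrite -y'E -wE -k'E zE embD; apply/rowP => i; rewrite !mxE; ring.
  have [[t [p [q [tT pP qQ zE]]]]|[t [q [q' [tT qQ q'Q zE]]]]] := cov z zA.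
    exists (s^-1 *: emb t); first by apply: (map_f (fun t => s^-1 *: emb t)); rewrite mem_cat tT.
    by apply: (fin _ _ zE); apply: grid_add => //; exact: QH.
  exists (s^-1 *: emb (t - x0)).
    apply: (map_f (fun t => s^-1 *: emb t)); rewrite mem_cat.
    by rewrite (map_f (fun t => t - x0) tT) orbT.
  apply: (fin _ (q + (x0 - q'))).
    by rewrite zE; apply/rowP => i; rewrite !mxE; ring.
  have : q + (x0 - q') \in H2 by apply: grid_add => //; [exact: QH|exact: Qsym].
  apply/fsubsetP/grid_mono => //; rewrite addr_ge0//= lerD2r.
  by rewrite -[leRHS]mul1r ler_wpM2r.
rewrite size_map size_cat size_map T1N natrD.
have NS : N%:R <= r * ln g + 1 by rewrite /N -natr1 lerD2r.
suff T2r : (size T2)%:R <= r by rewrite mulrDr mulr1; lra.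
rewrite -(ler_pM2r Q_gt0); apply: le_trans T2le _.
have : expR (- (N%:R * (#|` P|%:R / #|` W|%:R))) <= g^-1.
  rewrite expRN lef_pV2 ?posrE ?expR_gt0 ?(lt_le_trans _ g1)//.
  rewrite -[leLHS]lnK ?posrE ?(lt_le_trans _ g1)// ler_expR.
  rewrite -[_ / _]invf_div -/r ler_pdivlMr// mulrC; exact: ltW.
move=> /(ler_wpM2l (ltW W_gt0))/le_trans; apply.
have -> : #|` W|%:R * g^-1 = r * (#|` H|%:R ^+ 2 / #|` H2|%:R).
  by rewrite /r /g; field; rewrite !gt_eqF.
by rewrite ler_pM2l// ler_pdivrMr// mulrC -natrX -natrM ler_nat.
Qed.

(** The bound of [covered_by_counts] is a continuous function of four counts, each
divided by s^d. *)
Lemma cvg_count_bound (F : set_system R) {FF : Filter F} (w p h h2 : R -> R)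
    (w' p' h' h2' : R) : 0 < p' -> 0 < h' -> 0 < h2' ->
  w s @[s --> F] --> w' -> p s @[s --> F] --> p' -> h s @[s --> F] --> h' ->
  h2 s @[s --> F] --> h2' ->
  w s / p s * (ln (p s * h2 s / h s ^+ 2) + 1) + 1 @[s --> F] -->
  w' / p' * (ln (p' * h2' / h' ^+ 2) + 1) + 1.
Proof.
move=> p0 h0 h20 ww pp hh hh2.
have arg : p s * h2 s / h s ^+ 2 @[s --> F] --> p' * h2' / h' ^+ 2.
  apply: cvgM; first exact: cvgM.
  by apply: cvgV; [rewrite expf_neq0// gt_eqF|exact: cvgX].
have arg0 : 0 < p' * h2' / h' ^+ 2 by rewrite divr_gt0 ?exprn_gt0 ?mulr_gt0.
apply: cvgD; last exact: cvg_cst.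
apply: cvgM; first by apply: cvgM => //; apply: cvgV => //; rewrite gt_eqF.
apply: cvgD; last exact: cvg_cst.
exact: (cvg_comp _ _ arg (continuous_ln arg0)).
Qed.

Lemma solid_covering_bound K l (eta v e m : R) : solid K -> 0 < l ->
  0 < eta <= 1 -> 0 < v -> has_volume K v -> has_volume (minkdiff K l) e ->
  (forall n, covered K l n -> m <= n%:R) ->
  m <= e * (1 + eta) ^+ d / (l ^+ d * v) * (d%:R * ln (2 / eta) + 1) + 1.
Proof.
move=> sK l0 /andP[e0 e1] v0 Kv Ke mmin.
have [c c0 cK] := solid_cube sK.
have eta1 : 0 < 1 + eta by lra.
pose a := l / (1 + eta); have a0 : 0 < a by rewrite divr_gt0.
pose b s := a * s + - (c / (1 + eta)).
have Ecvg := volume_affine c Ke ltr01; rewrite expr1n mul1r in Ecvg.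
have Pcvg := volume_affine (- (c / (1 + eta))) Kv a0.
have ea0 := mulr_gt0 e0 a0; have eea0 := addr_gt0 ea0 ea0.
have Hcvg := volume_affine (eta * - (c / (1 + eta))) Kv ea0.
have H2cvg := volume_affine (eta * - (c / (1 + eta)) + eta * - (c / (1 + eta))) Kv eea0.
set aP := a ^+ d * v in Pcvg; set aH := (eta * a) ^+ d * v in Hcvg.
set aH2 := (eta * a + eta * a) ^+ d * v in H2cvg.
have aP0 : 0 < aP by exact: mulr_gt0 (exprn_gt0 _ a0) v0.
have aH0 : 0 < aH by exact: mulr_gt0 (exprn_gt0 _ ea0) v0.
have aH20 : 0 < aH2 by exact: mulr_gt0 (exprn_gt0 _ eea0) v0.
have ratio_cvg : e / aP * (ln (aP * aH2 / aH ^+ 2) + 1) + 1 =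
  e * (1 + eta) ^+ d / (l ^+ d * v) * (d%:R * ln (2 / eta) + 1) + 1.
  congr (_ * (_ + _) + _).
    rewrite /aP /a expr_div_n; field.
    by rewrite !expf_neq0 ?gt_eqF.
  rewrite mulr_natl -lnXn ?divr_gt0//; congr ln.
  rewrite /aP /aH2 /aH.
  have -> : eta * a + eta * a = 2 * eta * a by ring.
  move: (a) a0 => a' a'0.
  rewrite !(@exprMn _ d) exprVn.
  have : eta ^+ d != 0 by rewrite expf_neq0 ?gt_eqF.
  have : a' ^+ d != 0 by rewrite expf_neq0 ?gt_eqF.
  move: (eta ^+ d) (a' ^+ d) (2 ^+ d) => x y z y0 x0.
  by field; rewrite x0 y0 gt_eqF.
rewrite -ratio_cvg.
clear ratio_cvg; clearbody aP aH aH2.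
have lim := cvg_count_bound (F := pinfty_nbhs R) aP0 aH0 aH20 Ecvg Pcvg Hcvg H2cvg.
apply: (ler_cvg_to (cvg_cst m) (lim _)); near=> s => /=.
have s0 : 0 < s by near: s; exact: nbhs_pinfty_gt.
have sd0 : s ^+ d != 0 by rewrite expf_neq0// gt_eqF.
have sl : c / l <= s by near: s; apply: nbhs_pinfty_ge; exact: num_real.
have b0 : 0 <= b s.
  by rewrite /b subr_ge0 /a mulrAC ler_pM2r ?invr_gt0// mulrC -ler_pdivrMr.
have bE : (1 + eta) * b s = l * s - c.
  by rewrite /b /a; field; rewrite gt_eqF.
have e01 : 0 < eta <= 1 by rewrite e0.
have [n Kn nle] := covered_by_counts sK cK (ltW c0) (ltW l0) e01 s0 b0 bE.
apply: le_trans (mmin _ Kn) _; apply: le_trans nle _.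
have -> : eta * a * s + eta * - (c / (1 + eta)) = eta * b s by rewrite /b; ring.
have -> : (eta * a + eta * a) * s +
      (eta * - (c / (1 + eta)) + eta * - (c / (1 + eta))) = eta * b s + eta * b s.
  by rewrite /b; ring.
rewrite -/(b s) mul1r.
have H0 (x : R) : 0 <= x -> #|` grid K x|%:R != 0 :> R.
  by move=> x0; rewrite pnatr_eq0 -lt0n card_grid_gt0.
have P0 := H0 _ b0; have Hn0 := H0 _ (mulr_ge0 (ltW e0) b0).
set w : R := #|` grid (minkdiff K l) _|%:R.
set p : R := #|` grid K (b s)|%:R in P0 *.
set h : R := #|` grid K (eta * b s)|%:R in Hn0 *.
set h2 : R := #|` grid K (eta * b s + _)|%:R.
have -> : w / p = w / s ^+ d / (p / s ^+ d) by field; rewrite sd0.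
have -> // : p * h2 / h ^+ 2 = p / s ^+ d * (h2 / s ^+ d) / (h / s ^+ d) ^+ 2.
by field; rewrite sd0.
Unshelve. all: by end_near. Qed.
End Covering.

(** * The choice of the packing scale *)

Section Numerics.
Variable R : realType.

Lemma ln2_ge : 2^-1 <= ln (2 : R).
Proof.
rewrite -[leLHS]expRK ler_ln ?posrE ?expR_gt0//.
rewrite -lef_pV2 ?posrE ?expR_gt0// -expRN.
by apply: le_trans (expR_ge1Dx _); lra.
Qed.

Lemma ln2_le : ln (2 : R) <= 3 / 4.
Proof.
rewrite -[leRHS]expRK ler_ln ?posrE ?expR_gt0//.
(* (1 + 3/20)^5 is slightly larger than 2 *)
have -> : 3 / 4 = (3 / 20) * 5%:R :> R by lra.
rewrite expRM_natr.
apply: (@le_trans _ _ ((1 + 3 / 20) ^+ 5)); first by rewrite !exprS expr0; lra.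
by rewrite lerXn2r ?nnegrE ?expR_ge0// ?expR_ge1Dx//; lra.
Qed.

Lemma expR1_le3 : expR 1 <= 3 :> R.
Proof.
(* (6/5)^6 is slightly smaller than 3 *)
have -> : 1 = (1 / 6) * 6%:R :> R by lra.
rewrite expRM_natr.
have e65 : expR (1 / 6) <= 6 / 5 :> R.
  rewrite -[leLHS]invrK -expRN -[leRHS]invrK lef_pV2 ?posrE ?invr_gt0 ?expR_gt0//.
  by apply: le_trans (expR_ge1Dx _); lra.
apply: (@le_trans _ _ ((6 / 5) ^+ 6)); last by rewrite !exprS expr0; lra.
by rewrite lerXn2r ?nnegrE ?expR_ge0//; lra.
Qed.

(** The factor (1 + eta)^d should be 1 + O(1/ln d) without making ln (2/eta) much
larger than ln d, which forces eta to be of order 1/(d ln d). *)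
Lemma exists_good_eta (d : nat) : (2 <= d)%N -> exists2 eta : R, 0 < eta <= 1 &
  (1 + eta) ^+ d * (d%:R * ln (2 / eta) + 1) + 1 <=
    d%:R * (ln d%:R + ln (ln d%:R) + 5).
Proof.
rewrite leq_eqVlt => /predU1P[<-|d3].
  (* The estimates of the case d >= 3 rely on ln d >= 1. Here the bound
     ln 2 >= 1/2 makes ln 2 + ln ln 2 nonnegative. *)
  exists (1 / 4); first by lra.
  have -> : 2 / (1 / 4) = 2 ^+ 3 :> R by rewrite !exprS expr0; lra.
  rewrite lnXn//.
  have l2 := ln2_ge; have l2' := ln2_le.
  have ll2 : - ln 2 <= ln (ln 2) :> R.
    by rewrite -lnV ?posrE// ler_ln ?posrE ?invr_gt0 ?(lt_le_trans _ l2)// invr_gt0.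
  by rewrite !exprS expr0; lra.
set D : R := d%:R; set L := ln D.
have D3 : 3 <= D by rewrite ler_nat.
have L1 : 1 <= L.
  by rewrite -[leLHS]expRK ler_ln ?posrE ?expR_gt0//; [exact: le_trans expR1_le3 D3|lra].
have L0 : 0 < L by lra.
have D0 : 0 < D by lra.
exists (2 * D * L)^-1.
  by rewrite invr_gt0 invf_le1 ?mulr_gt0//=; nra.
set u := ln L.
have u0 : 0 <= u by rewrite ln_ge0.
have uL : u <= L - 1 by rewrite /u -{1}[L](subrK 1) addrC le_ln1Dx//; lra.
have -> : ln (2 / (2 * D * L)^-1) = ln 2 + ln 2 + (L + u).
  by rewrite invrK !lnM ?posrE ?mulr_gt0// -/L -/u; ring.
have l2' := ln2_le.
have pow : (1 + (2 * D * L)^-1) ^+ d <= 1 + L^-1.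
  apply: (@le_trans _ _ (expR ((2 * L)^-1))).
    have -> : (2 * L)^-1 = (2 * D * L)^-1 * D by field; rewrite !gt_eqF.
    rewrite expRM_natr lerXn2r ?nnegrE ?expR_ge0 ?expR_ge1Dx//.
    by rewrite addr_ge0 ?invr_ge0// ltW// !mulr_gt0.
  rewrite -[leLHS]invrK -expRN.
  have h : 1 - (2 * L)^-1 <= expR (- (2 * L)^-1) by exact: expR_ge1Dx.
  have i1 : L^-1 <= 1 by rewrite invf_le1.
  have i0 : 0 < L^-1 by rewrite invr_gt0.
  rewrite invfM in h *.
  rewrite -[leRHS]invrK lef_pV2 ?posrE ?invr_gt0 ?expR_gt0 ?addr_gt0//.
  apply: le_trans h; rewrite -[leLHS]mul1r ler_pdivrMr ?addr_gt0//.
  nra.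
have pos : 0 <= D * (ln 2 + ln 2 + (L + u)) + 1.
  by have l2 := ln2_ge; rewrite addr_ge0// mulr_ge0 ?(ltW D0)//; lra.
apply: (@le_trans _ _ ((1 + L^-1) * (D * (3 / 2 + L + u) + 1) + 1)).
  rewrite lerD2r; apply: ler_pM => //.
    by rewrite exprn_ge0// addr_ge0// invr_ge0 ltW// !mulr_gt0.
  by rewrite lerD2r ler_pM2l//; lra.
have i1 : L^-1 <= 1 by rewrite invf_le1.
have i0 : 0 < L^-1 by rewrite invr_gt0.
have iL : L^-1 * L = 1 by rewrite mulVf// gt_eqF.
have iu : L^-1 * u <= 1 - L^-1.
  by have := ler_wpM2l (ltW i0) uL; rewrite mulrBr mulr1 iL.
set i := L^-1 in i1 i0 iL iu *.
have -> : (1 + i) * (D * (3 / 2 + L + u) + 1) + 1 =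
  D * (3 / 2 + L + u) + D * (i * L + i * u + 3 / 2 * i) + 2 + i by ring.
rewrite iL.
have : D * (1 + i * u + 3 / 2 * i) <= D * (5 / 2).
  by rewrite ler_pM2l//; lra.
lra.
Qed.
End Numerics.

(** * Convex bodies and the covering index *)

Section Bodies.
Context {R : realType} {d : nat}.
Implicit Types (K : set 'rV[R]_d) (p : 'rV[R]_d).

Lemma convex_setE K x y (t : R) : convex_set K -> 0 <= t <= 1 -> K x -> K y ->
  K (t *: x + (1 - t) *: y).
Proof.
move=> cK /andP[t0 t1] Kx Ky.
have := cK x y (Itv01 t0 t1); rewrite !inE; exact.
Qed.

Lemma norm_entry_le (x : 'rV[R]_d) i : `|x 0 i| <= `|x|.
Proof.
rewrite [leRHS]mx_normrE.
exact: (le_bigmax _ (fun ij : 'I_1 * 'I_d => `|x ij.1 ij.2|) (0, i)).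
Qed.

Lemma solid_of_body K p : convex_body K -> K° p -> solid [set x - p | x in K].
Proof.
move=> [cK vK _] /nbhs_ballP[r /= r0 prK]; split.
- move=> _ _ t t01 [x Kx <-] [y Ky <-].
  exists (t *: x + (1 - t) *: y); first exact: convex_setE.
  by apply/rowP => i; rewrite !mxE; ring.
- exists (r / 2); first by rewrite divr_gt0.
  move=> x xr; exists (x + p); last by rewrite addrK.
  apply: prK; split=> // i j; rewrite ord1 -ball_normE /= !mxE opprD addrCA subrr.
  rewrite addr0 normrN; apply: le_lt_trans (xr j) _.
  by rewrite ltr_pdivrMr//; lra.
- have [M M0 KM] := pinfty_ex_gt0 (compact_bounded cK).
  exists (M + `|p|) => _ [x Kx <-] i; rewrite !mxE.
  apply: le_trans (ler_normB _ _) _; rewrite lerD ?norm_entry_le//.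
  exact: le_trans (norm_entry_le _ _) (KM _ Kx).
Qed.

(** 0 is the midpoint of -p and of the centre p of a ball contained in K. *)
Lemma symmetric_interior0 K : convex_body K -> o_symmetric K -> K° 0.
Proof.
move=> [_ vK [p pK]] sK; move/nbhs_ballP: (pK) => [r /= r0 prK].
apply/nbhs_ballP; exists (r / 2); first by rewrite /= divr_gt0.
move=> x; rewrite -ball_normE /= sub0r normrN => xr.
have Kp : K (- p).
  by rewrite sK; exists p => //; exact: interior_subset pK.
have Kpx : K (p + 2 *: x).
  apply: prK; rewrite -ball_normE /= opprD addrA subrr add0r normrN normrZ.
  by rewrite ger0_norm// mulrC -ltr_pdivlMr.
have := @convex_setE K _ _ (1 / 2) vK _ Kpx Kp.
have -> : 1 / 2 *: (p + 2 *: x) + (1 - 1 / 2) *: - p = x.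
  by apply/rowP => i; rewrite !mxE; field.
by apply; lra.
Qed.

Lemma covered_translate K p (l : R) n :
  covered [set x - p | x in K] l n -> covered K l n.
Proof.
move=> [t tK]; exists (fun i => t i + p - l *: p) => x Kx.
have [|i _ [_ [y Ky <-] E]] := tK (x - p); first by exists x.
exists i => //; exists y => //.
rewrite -[x](subrK p) -E.
by apply/rowP => j; rewrite !mxE; ring.
Qed.

Lemma coin_w_le K (l : R) : convex_body K -> 0 < l -> l < 1 ->
  coin_w K <= (covering_number l K)%:R / (1 - l).
Proof.
move=> Kb l0 l1; have [KN _] := covering_numberP Kb l0.
set N := covering_number l K in KN *.
have N0 : (0 < N)%N.
  case: (N) KN => // -[t Kt]; case: Kb => _ _ [p /interior_subset/Kt].
  by case=> -[].
have gl : covering_functional N K <= l.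
  by apply: ge_inf; [exists 0 => x [/ltW]|split].
apply: (@le_trans _ _ (N%:R / (1 - covering_functional N K))).
  apply: ge_inf.
    exists 0 => _ [m [_ m1] <-]; by rewrite divr_ge0// subr_ge0 ltW.
  by exists N => //; split=> //; exact: le_lt_trans l1.
rewrite ler_wpM2l// lef_pV2 ?posrE ?subr_gt0//; last exact: le_lt_trans l1.
by rewrite lerD2l lerN2.
Qed.

(** K - l K contains -l K. *)
Lemma volume_minkdiff_ge K (l v e : R) : solid K -> 0 < l ->
  has_volume K v -> has_volume (minkdiff K l) e -> l ^+ d * v <= e.
Proof.
move=> sK l0 Kv Ke; have sE := solid_minkdiff (ltW l0) sK.
apply: (ler_cvg_to (volume_affine 0 Kv l0) Ke); near=> s.
have s0 : 0 < s by near: s; exact: nbhs_pinfty_gt.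
rewrite ler_pM2r ?invr_gt0 ?exprn_gt0// ler_nat addr0 -card_oppset.
apply/fsubset_leq_card/fsubsetP => z; rewrite mem_oppset.
move=> /(gridP _ sK (mulr_ge0 (ltW l0) (ltW s0)))[x Kx zE].
apply/(gridP _ sE (ltW s0)); exists (0 - l *: x).
  by exists 0; [exact: solid0|exists x].
by rewrite -[z]opprK embN zE sub0r scalerN scalerA mulrC.
Unshelve. all: by end_near. Qed.

Lemma volume_minkdiff_symmetric K (l v e : R) : solid K -> o_symmetric K -> 0 < l ->
  has_volume K v -> has_volume (minkdiff K l) e -> e <= (1 + l) ^+ d * v.
Proof.
move=> sK symK l0 Kv Ke; have sE := solid_minkdiff (ltW l0) sK.
have l10 : 0 < 1 + l by lra.
apply: (ler_cvg_to Ke (volume_affine 0 Kv l10)); near=> s.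
have s0 : 0 < s by near: s; exact: nbhs_pinfty_gt.
rewrite ler_pM2r ?invr_gt0 ?exprn_gt0// ler_nat addr0.
apply/fsubset_leq_card/fsubsetP => z /(gridP _ sE (ltW s0))[x0 [x Kx [y Ky <-]] zE].
have Ky' : K (- y) by rewrite symK; exists y.
have [u Ku uE] := solid_add sK ler01 (ltW l0) Kx Ky'.
apply/(gridP _ sK (mulr_ge0 (ltW l10) (ltW s0))); exists u => //.
rewrite zE [_ * s]mulrC -scalerA -uE; apply/rowP => i; rewrite !mxE; ring.
Unshelve. all: by end_near. Qed.

(** With p, q, r the d-th roots of the volumes of K - l K, K and K - K,
Brunn-Minkowski gives p <= r - (1 - l) q, and Rogers-Shephard bounds r. *)
Lemma volume_minkdiff_le K (l v e : R) : (0 < d)%N -> solid K -> 0 < l < 1 -> 0 < v ->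
  has_volume K v -> has_volume (minkdiff K l) e ->
  e <= ('C(2 * d, d)%:R `^ (d%:R)^-1 - 1 + l) ^+ d * v.
Proof.
move=> d0 sK /andP[l0 l1] v0 Kv Ke.
have [w w0 Kw] := solid_volume (solid_minkdiff ler01 sK).
have e0 : 0 < e.
  by apply: lt_le_trans (volume_minkdiff_ge sK l0 Kv Ke); rewrite mulr_gt0 ?exprn_gt0.
have root_gt0 (x y : R) : 0 <= x -> x ^+ d = y -> 0 < y -> 0 < x.
  move=> x0 xy y0; rewrite lt_neqAle x0 andbT; apply/eqP => xz; move: y0.
  by rewrite -xy -xz expr0n gtn_eqF// ltxx.
have [p p0 pe] := exists_root d0 (ltW e0); have [q q0 qv] := exists_root d0 (ltW v0).
have [r r0 rw] := exists_root d0 (ltW w0).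
have {}p0 := root_gt0 _ _ p0 pe e0; have {}q0 := root_gt0 _ _ q0 qv v0.
have l01 : 0 <= l < 1 by rewrite ltW.
have BM := volume_brunn_minkowski d0 sK l01 Kv Ke Kw p0 q0 r0 pe qv rw.
have RS := volume_rogers_shephard d0 sK v0 Kv Kw.
set B := _ `^ _.
have BE : B ^+ d = 'C(2 * d, d)%:R.
  rewrite /B -powR_mulrn ?powR_ge0// -powRrM mulVf ?powRr1//.
  by rewrite pnatr_eq0 -lt0n.
have rB : r <= B * q.
  rewrite -(ler_pXn2r d0) ?nnegrE ?mulr_ge0 ?powR_ge0 ?(ltW q0)//.
  by rewrite exprMn rw BE qv.
have pB : p <= (B - 1 + l) * q by lra.
rewrite -pe -qv -exprMn lerXn2r ?nnegrE ?(ltW p0)//.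
exact: le_trans (ltW p0) pB.
Qed.

End Bodies.

(** The additive 1 in [solid_covering_bound] is absorbed by the factor
e / (l^d v), which is at least 1 by [volume_minkdiff_ge]. *)
Lemma covering_number_volume_bound (R : realType) (d : nat) (K : set 'rV[R]_d)
    (p : 'rV[R]_d) (l v e : R) : (2 <= d)%N -> convex_body K -> K° p -> 0 < l ->
  0 < v -> has_volume [set x - p | x in K] v ->
  has_volume (minkdiff [set x - p | x in K] l) e ->
  (covering_number l K)%:R <=
    e / (l ^+ d * v) * (d%:R * (ln d%:R + ln (ln d%:R) + 5)).
Proof.
move=> d2 Kb pK l0 v0 Kv Ke; have sK := solid_of_body Kb pK.
have [_ Nmin] := covering_numberP Kb l0.
have [eta eta01 etaP] := @exists_good_eta R d d2.
have lv0 : 0 < l ^+ d * v by rewrite mulr_gt0 ?exprn_gt0.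
have ge1 : 1 <= e / (l ^+ d * v).
  by rewrite ler_pdivlMr// mul1r (volume_minkdiff_ge sK l0 Kv Ke).
apply: (le_trans (solid_covering_bound sK l0 eta01 v0 Kv Ke _)).
  by move=> n /covered_translate Kn; rewrite ler_nat Nmin.
apply: le_trans (ler_wpM2l (le_trans ler01 ge1) etaP).
rewrite [leRHS]mulrDr mulr1; apply: lerD => //.
by rewrite [e * _ / _]mulrAC mulrA.
Qed.

Theorem theorem7p1 (R : realType) (d : nat) (hd : (2 <= d)%N)
    (K : set 'rV[R]_d) (hK : convex_body K)
    (lambda : R) (hl0 : 0 < lambda) (hl1 : lambda < 1) :
  coin_w K <= (covering_number lambda K)%:R / (1 - lambda)
  /\ (covering_number lambda K)%:R / (1 - lambda) <=
     if `[< o_symmetric K >] then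
       (1 + lambda) ^+ d / (lambda ^+ d * (1 - lambda))
       * (d%:R * (ln d%:R + ln (ln d%:R) + 5))
     else
       1 / (lambda ^+ d * (1 - lambda))
       * ('C(2 * d, d)%:R `^ (d%:R)^-1 - 1 + lambda) ^+ d
       * (d%:R * (ln d%:R + ln (ln d%:R) + 5)).
Proof.
split; first exact: coin_w_le.
have l10 : 0 < 1 - lambda by lra.
have D0 : 0 <= d%:R * (ln d%:R + ln (ln d%:R) + 5) :> R.
  have [eta /andP[e0 e1] le] := @exists_good_eta R d hd.
  apply: le_trans le; rewrite addr_ge0// mulr_ge0 ?exprn_ge0//; first by lra.
  rewrite addr_ge0// mulr_ge0// ln_ge0// ler_pdivlMr//; lra.
set D := d%:R * _ in D0 *.
have bound p (B : R) : K° p ->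
    (forall v e : R, solid [set x - p | x in K] -> 0 < v ->
      has_volume [set x - p | x in K] v ->
      has_volume (minkdiff [set x - p | x in K] lambda) e -> e <= B * v) ->
    (covering_number lambda K)%:R / (1 - lambda) <=
    B / (lambda ^+ d * (1 - lambda)) * D.
  move=> pK BP; have sK := solid_of_body hK pK.
  have [v v0 Kv] := solid_volume sK.
  have [e e0 Ke] := solid_volume (solid_minkdiff (ltW hl0) sK).
  have := covering_number_volume_bound hd hK pK hl0 v0 Kv Ke.
  rewrite -/D => H; rewrite ler_pdivrMr//; apply: le_trans H _.
  have -> : B / (lambda ^+ d * (1 - lambda)) * D * (1 - lambda) =
      B * v / (lambda ^+ d * v) * D.
    have ld0 : lambda ^+ d != 0 by rewrite expf_neq0// gt_eqF.
    by field; rewrite ld0 !gt_eqF.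
  rewrite ler_wpM2r// ler_pM2r ?invr_gt0 ?mulr_gt0 ?exprn_gt0//.
  exact: BP.
case: asboolP => [symK|_].
  apply: (bound 0); first exact: symmetric_interior0.
  have -> : [set x - 0 | x in K] = K.
    by apply/seteqP; split=> x /=; [case=> y Ky <-; rewrite subr0|exists x; rewrite ?subr0].
  by move=> v e sK _; exact: volume_minkdiff_symmetric.
have [_ _ [p pK]] := hK; rewrite mul1r [_^-1 * _]mulrC.
apply: (bound p) => // v e sK v0; apply: volume_minkdiff_le => //.
  exact: ltnW.
by rewrite hl0.
Qed.
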